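(* Let $K'$ be a field of characteristic $0$ with henselian valuation ring $A'$ and residue field of characteristic $p>2$. Let $L'|K'$ be a non-trivial Galois extension of degree $p$ with valuation ring $B'$. Let $\zeta$ be a primitive $p$-th root of unity, $K=K'(\zeta)$, $L=L'(\zeta)$ with valuation rings $A,B$, $\sigma$ a generator of $\mathrm{Gal}(L|K)$, $\Lambda=\mathrm{Gal}(L|L')$. Then $\mathcal{H}'=\mathcal{N}'$.
   Context: Put $\mathfrak{z}=\zeta-1$ and let $\mathfrak{A}$ be the set of $h\in K$ such that the solutions of $X^p=h$ generate $L$ over $K$; $\mathcal{H}$ is the ideal of $A$ generated by $\{\mathfrak{z}^p/(h-1):h\in\mathfrak{A}\}$, and $\mathcal{H}'=\mathcal{H}^\Lambda$ (invariants under $\Lambda\cong\mathrm{Gal}(K|K')$), an ideal of $A'$. $\mathcal{J}'$ is the ideal of $B'$ generated by $\{\sigma(b)/b-1:b\in L'^\times\}$ and $\mathcal{N}'$ the ideal of $A'$ generated by $N_{L'|K'}(\mathcal{J}')$. *)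

(* Defs.v *)
From HB Require Import structures.
From mathcomp Require Import all_boot all_order all_algebra all_fingroup all_solvable all_field.
Set Implicit Arguments. Unset Strict Implicit. Unset Printing Implicit Defensive.
Import GRing.Theory.
Local Open Scope ring_scope.

(* All fields are realised as subfields of an ambient finite Galois
   (splitting-field) extension Om of the base field F0 = K'.  Subsets of Om are
   Prop-valued predicates Om -> Prop. *)

Section Defs.
Variables (F0 : fieldType) (Om : splittingFieldType F0).

Definition is_valuation_ring (E : {vspace Om}) (V : Om -> Prop) : Prop :=
  [/\ (forall x, V x -> x \in E), V 0, V 1,
      (forall x y, V x -> V y -> V (x - y) /\ V (x * y)) &
      (forall x, x \in E -> x != 0 -> V x \/ V x^-1)].

Definition vmax (V : Om -> Prop) (x : Om) : Prop := V x /\ (x = 0 \/ ~ V x^-1).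

Definition henselian (V : Om -> Prop) : Prop :=
  forall (f : {poly Om}) (a : Om),
    f \is monic -> (forall i, V f`_i) -> V a ->
    vmax V f.[a] -> ~ vmax V (f^`()).[a] ->
    exists b, [/\ V b, f.[b] = 0 & vmax V (b - a)].

Definition ideal_gen (R S : Om -> Prop) (x : Om) : Prop :=
  exists rs : seq (Om * Om),
    (forall q, q \in rs -> R q.1 /\ S q.2) /\ x = \sum_(q <- rs) q.1 * q.2.

Definition setI_sp (V : Om -> Prop) (E : {vspace Om}) (x : Om) : Prop :=
  V x /\ x \in E.

Definition frakA (p : nat) (K L : {subfield Om}) (h : Om) : Prop :=
  h \in K /\ exists alpha : Om, alpha ^+ p = h /\ <<K; alpha>>%VS = L.

Definition calH (p : nat) (zeta : Om) (K L : {subfield Om}) (A : Om -> Prop) :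
  Om -> Prop :=
  ideal_gen A (fun y => exists h, frakA p K L h /\ y = (zeta - 1) ^+ p / (h - 1)).

Definition calH' (p : nat) (zeta : Om) (K L L' : {subfield Om})
  (A : Om -> Prop) (x : Om) : Prop :=
  calH p zeta K L A x /\ forall tau, tau \in 'Gal(L / L')%g -> tau x = x.

Definition calJ' (L L' : {subfield Om}) (sigma : gal_of L) (B' : Om -> Prop) :
  Om -> Prop :=
  ideal_gen B' (fun y => exists b, [/\ b \in L', b != 0 & y = sigma b / b - 1]).

Definition calN' (L L' : {subfield Om}) (sigma : gal_of L) (A' B' : Om -> Prop) :
  Om -> Prop :=
  ideal_gen A' (fun y => exists j, @calJ' L L' sigma B' j /\ y = galNorm 1%VS L' j).

End Defs.

(* Main.v *)
Require Import Defs.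
From HB Require Import structures.
From mathcomp Require Import all_boot all_order all_algebra all_fingroup all_solvable all_field.
From mathcomp Require Import ring.
From mathcomp Require boolp classical_sets.
Set Implicit Arguments. Unset Strict Implicit. Unset Printing Implicit Defensive.
Import GRing.Theory.
Local Open Scope ring_scope.

(* Write v for the valuation, z = zeta - 1.  Ideals of valuation rings are unions
   of principal ones, v is Galois invariant, and v(h - 1) = p v(a - 1) whenever
   a^p = h; so the claim compares the values v(z) - v(a - 1), for Kummer
   generators a of L over K, with the values v(sigma b / b - 1), for b in L'.
   Taking b = a or b = a - 1 gives an element of L, and since K | K' is tame a
   suitable trace Tr(z^i b) gives one in L' whose value is not larger.
   Conversely b = f(a) with f over K of degree < p.  Each root rho of f has degree
   prime to p over K, so that the mean k of its conjugates satisfies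
   v(a - k) >= v(a - rho), and expanding f(zeta a) / f(a) over the roots gives
   v(sigma b / b - 1) >= v(z a) - v(a - k) for one of these k; then a / k is the
   required Kummer generator.  The roots live in a Galois extension of F0 to which
   the valuation extends by Chevalley's theorem. *)

(** * Chevalley extension of valuation rings *)

(** The value group is arbitrary: neither ideal need be principal, and the values v(a - k), k in K,
    need not have a maximum. Hence only single elements are compared, each inclusion is proved
    generator by generator, and the k belonging to a given b is chosen among finitely many
    approximations of the roots of f. That A' is henselian enters in a single way, as v(g x) = v(x)
    for automorphisms g over K': this gives the norm of j in L' the value p v(j), the factors of a^p
    - 1 a common value, and the conjugates of a root a common distance from a. The last use is why
    the field of the roots has to be Galois over K' and not merely over L. The number p enters by
    two facts: [K : K'] < p is prime to [L' : K'] = p, so that K and L' meet in K', and the positive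
    integers below p are units, so that means can be formed. *)

Section Chevalley.
Variables (M : fieldType).
Implicit Types (R I m : M -> Prop) (x y : M) (q : {poly M}).

Definition subring_pred R :=
  [/\ R 0, R 1 & forall x y, R x -> R y -> R (x - y) /\ R (x * y)].

Definition valuation_ring R := 
  subring_pred R /\ forall x, x != 0 -> R x \/ R x^-1.

Section Subring.
Variables (R : M -> Prop) (hR : subring_pred R).

Lemma subring_pred0 : R 0. Proof. by case: hR. Qed.
Lemma subring_pred1 : R 1. Proof. by case: hR. Qed.
Lemma subring_predB x y : R x -> R y -> R (x - y).
Proof. by case: hR => _ _ h hx hy; case: (h _ _ hx hy). Qed.
Lemma subring_predM x y : R x -> R y -> R (x * y).
Proof. by case: hR => _ _ h hx hy; case: (h _ _ hx hy). Qed.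
Lemma subring_predN x : R x -> R (- x).
Proof. by move=> hx; rewrite -sub0r; apply: subring_predB => //; exact: subring_pred0. Qed.
Lemma subring_predD x y : R x -> R y -> R (x + y).
Proof. by move=> hx hy; rewrite -[y]opprK; apply: subring_predB => //; exact: subring_predN. Qed.
Lemma subring_predX x n : R x -> R (x ^+ n).
Proof.
by move=> hx; elim: n => [|n IH]; rewrite ?expr0 ?exprS; [exact: subring_pred1 | exact: subring_predM].
Qed.
Lemma subring_pred_nat n : R n%:R.
Proof. by elim: n => [|n IH]; [exact: subring_pred0 | rewrite -natr1; exact: subring_predD (subring_pred1)]. Qed.
Lemma subring_pred_sum T (s : seq T) (P : pred T) F :
  (forall i, P i -> R (F i)) -> R (\sum_(i <- s | P i) F i).
Proof. by move=> h; elim/big_ind: _ => //; [exact: subring_pred0 | exact: subring_predD]. Qed.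
Lemma subring_pred_prod T (s : seq T) (P : pred T) F :
  (forall i, P i -> R (F i)) -> R (\prod_(i <- s | P i) F i).
Proof. by move=> h; elim/big_ind: _ => //; [exact: subring_pred1 | exact: subring_predM]. Qed.
Lemma subring_pred_sum_seq (T : eqType) (s : seq T) F :
  (forall i, i \in s -> R (F i)) -> R (\sum_(i <- s) F i).
Proof. by move=> h; rewrite big_seq; apply: subring_pred_sum. Qed.

End Subring.

Inductive ideal_span R m : M -> Prop :=
| ideal_span0 : ideal_span R m 0
| ideal_spanD a r x :
    m a -> R r -> ideal_span R m x -> ideal_span R m (a * r + x).

Lemma ideal_span_add R m x y :
  ideal_span R m x -> ideal_span R m y -> ideal_span R m (x + y).
Proof.
move=> hx hy; elim: hx => [|a r x' ma Rr _ IH]; first by rewrite add0r.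
by rewrite -addrA; apply: ideal_spanD.
Qed.

Lemma ideal_span_mul R m x y : subring_pred R ->
  ideal_span R m x -> R y -> ideal_span R m (x * y).
Proof.
move=> hR hx hy; elim: hx => [|a r x' ma Rr _ IH].
  by rewrite mul0r; exact: ideal_span0.
by rewrite mulrDl -mulrA; apply: ideal_spanD => //; exact: subring_predM.
Qed.

Lemma ideal_span_sub R m x : subring_pred R -> (forall a, m a -> R a) ->
  ideal_span R m x -> R x.
Proof.
move=> hR mR; elim=> [|a r x' ma Rr _ IH]; first exact: subring_pred0.
by apply: subring_predD => //; apply: subring_predM => //; exact: mR.
Qed.

Lemma ideal_span_sum R m T (s : seq T) (P : pred T) F :
  (forall i, P i -> ideal_span R m (F i)) -> ideal_span R m (\sum_(i <- s | P i) F i).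
Proof.
move=> h; elim/big_ind: _ => //; first exact: ideal_span0.
exact: ideal_span_add.
Qed.

Definition adjoin_pred R x y := exists2 q : {poly M}, (forall i, R q`_i) & y = q.[x].

Lemma adjoin_pred_subring R x : subring_pred R -> subring_pred (adjoin_pred R x).
Proof.
move=> hR; split.
- by exists 0; rewrite ?horner0 // => i; rewrite coef0; exact: subring_pred0.
- exists 1; rewrite ?hornerC // => i; rewrite coef1; exact: subring_pred_nat.
move=> _ _ [q hq ->] [r hr ->]; split.
  exists (q - r); first by move=> i; rewrite coefB; exact: subring_predB.
  by rewrite hornerD hornerN.
exists (q * r); last by rewrite hornerM.
by move=> i; rewrite coefM; apply: subring_pred_sum => // j _; exact: subring_predM.
Qed.

Lemma adjoin_pred_gen R x : subring_pred R -> adjoin_pred R x x.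
Proof.
move=> hR; exists 'X; last by rewrite hornerX.
by move=> i; rewrite coefX; exact: subring_pred_nat.
Qed.

Lemma adjoin_pred_incl R x y : subring_pred R -> R y -> adjoin_pred R x y.
Proof.
move=> hR hy; exists y%:P; last by rewrite hornerC.
by move=> i; rewrite coefC; case: ifP => // _; exact: subring_pred0.
Qed.

(** Turns 1 in m R[x] into a relation 1 = q(x) with coefficients in m R, whose degree can then be
    lowered. *)
Lemma ideal_span_adjoin R m x y : ideal_span (adjoin_pred R x) m y ->
  exists2 q : {poly M}, (forall i, ideal_span R m q`_i) & y = q.[x].
Proof.
elim=> [|a _ y' ma [r hr ->] _ [q hq ->]].
  by exists 0; rewrite ?horner0 // => i; rewrite coef0; exact: ideal_span0.
exists (a *: r + q); last by rewrite hornerD hornerZ.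
by move=> i; rewrite coefD coefZ; apply: ideal_spanD.
Qed.

(* A subring R, maximal among those containing R0 in which m does not generate
   the unit ideal, is a valuation ring: if neither x nor x^-1 lies in R, then
   1 = q(x) = q'(x^-1) with coefficients in m R, and the relation of larger
   degree can be shortened using the other one, since 1 + m R consists of units
   of R. *)
Theorem chevalley R0 m : subring_pred R0 -> (forall a, m a -> R0 a) ->
  ~ ideal_span R0 m 1 ->
  exists V, [/\ valuation_ring V, forall x, R0 x -> V x &
    forall x, m x -> x = 0 \/ ~ V x^-1].
Proof.
move=> hR0 mR0 R0m.
pose good R := [/\ subring_pred R, forall x, R0 x -> R x & ~ ideal_span R m 1].
have [|R [goodR maxR]] := @classical_sets.Zorn_bigcup M
  (fun R => R = classical_sets.set0 \/ good R).
  move=> F FP totF.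
  have [[R1 [FR1 goodR1]]|nogood] := boolp.pselect (exists R, F R /\ good R); last first.
    left; apply/classical_sets.seteqP; split=> // x [R FR Rx].
    have [R0'|gR] := FP R FR; first by rewrite R0' in Rx.
    by case: nogood; exists R.
  have pick2 R S x y : F R -> F S -> R x -> S y -> exists T, [/\ F T, T x & T y].
    move=> FR FS Rx Sy; have [RS|SR] := totF R S FR FS.
      by exists S; split=> //; exact: RS.
    by exists R; split=> //; exact: SR.
  have goodF R x : F R -> R x -> good R.
    by move=> FR Rx; case: (FP R FR) => // R0'; rewrite R0' in Rx.
  have [hR1 R01 _] := goodR1.
  right; split.
  - split; first by exists R1 => //; exact: subring_pred0.
      by exists R1 => //; exact: subring_pred1.
    move=> x y [R FR Rx] [S FS Sy]; have [T [FT Tx Ty]] := pick2 R S x y FR FS Rx Sy.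
    have [hT _ _] := goodF T x FT Tx.
    by split; exists T => //; [exact: subring_predB | exact: subring_predM].
  - by move=> x /R01 ?; exists R1.
  have spanF x : ideal_span (classical_sets.bigcup F id) m x ->
      exists S, F S /\ ideal_span S m x.
    elim=> [|a r {}x ma [S FS Sr] _ [T [FT hT]]].
      by exists R1; split=> //; exact: ideal_span0.
    have mono (A B : M -> Prop) y : (forall z, A z -> B z) ->
        ideal_span A m y -> ideal_span B m y.
      move=> AB; elim=> [|a' r' y' ? ? _ ?]; first exact: ideal_span0.
      by apply: ideal_spanD => //; exact: AB.
    have [ST|TS] := totF S T FS FT.
      by exists T; split=> //; apply: ideal_spanD => //; exact: ST.
    by exists S; split=> //; apply: ideal_spanD => //; exact: mono hT.
  move=> /spanF[S [FS S1]].
  case: (FP S FS) => [S0|[_ _]//].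
  move: S1; rewrite S0 => S1; case: R0m.
  move: S1; elim=> [|a r x ma // _]; first exact: ideal_span0.
have {}goodR : good R.
  case: goodR => // R0'; exfalso; apply: (maxR R0); last by right; split.
  rewrite R0'; split=> // /(_ 0 (subring_pred0 hR0)) //.
have [hR R0R Rm] := goodR.
have mR a : m a -> R a by move=> /mR0/R0R.
have extend x : ~ R x -> exists2 q : {poly M}, (forall i, ideal_span R m q`_i) & q.[x] = 1.
  move=> Rx; have [|bad] := boolp.pselect (ideal_span (adjoin_pred R x) m 1).
    by case/ideal_span_adjoin => q hq E; exists q.
  exfalso; apply: (maxR (adjoin_pred R x)).
    split; first by move=> y; exact: adjoin_pred_incl.
    by move=> /(_ x (adjoin_pred_gen x hR)).
  right; split=> //; first exact: adjoin_pred_subring.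
  by move=> y /R0R; exact: adjoin_pred_incl.
have IM a b : ideal_span R m a -> R b -> ideal_span R m (a * b).
  exact: ideal_span_mul.
have IR a : ideal_span R m a -> R a by exact: ideal_span_sub.
have unit1 i : ideal_span R m i -> 1 - i != 0 /\ R (1 - i)^-1.
  move=> Ii; have nz : 1 - i != 0.
    by rewrite subr_eq0; apply/eqP => E; apply: Rm; rewrite E.
  (* If u = 1 - i had no inverse in [R], then 1 = q(u^-1); multiplying by u^n puts u^n in m R, and
     u^k = u^(k+1) + i u^k lowers the exponent down to 0. *)
  split=> //; case: (boolp.pselect (R (1 - i)^-1)) => // /extend[q hq q1].
  case: Rm; pose u := 1 - i; pose n := size q.
  have Ru : R u by apply: subring_predB => //; [exact: subring_pred1 | exact: IR].
  have : ideal_span R m (u ^+ n).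
    rewrite -[u ^+ n]mul1r -q1 horner_coef mulr_suml.
    apply: ideal_span_sum => j _; rewrite -mulrA; apply: IM => //.
    rewrite exprVn mulrC -expfB; last exact: ltn_ord.
    exact: subring_predX.
  elim: (n) => [//|k IH]; rewrite exprS mulrBl mul1r => h; apply: IH.
  rewrite -[u ^+ k](subrK (i * u ^+ k)); apply: ideal_span_add => //.
  by apply: IM => //; exact: subring_predX.
have shorten N x (q q' : {poly M}) : x != 0 -> (forall i, ideal_span R m q`_i) ->
    (forall i, ideal_span R m q'`_i) -> q.[x] = 1 -> q'.[x^-1] = 1 ->
    (size q + size q' <= N)%N -> False.
  elim: N x q q' => [|N IH] x q q' x0 Iq Iq' qx q'x szN.
    move: szN; rewrite leqn0 addn_eq0 size_poly_eq0 => /andP[/eqP q0 _].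
    by move: qx; rewrite q0 horner0 => /esym/eqP; rewrite oner_eq0.
  wlog szqq' : x q q' x0 Iq Iq' qx q'x szN / (size q' <= size q)%N.
    move=> wl; have [le|/ltnW le] := leqP (size q') (size q).
      exact: (wl x q q').
    by apply: (wl x^-1 q' q) => //; rewrite ?invr_eq0 ?invrK // addnC.
  have [u0 Ru] := unit1 _ (Iq' 0).
  set u := (1 - _)^-1 in Ru.
  case szq : (size q) szN szqq' => [|n] szN szqq'.
    move/eqP: szq; rewrite size_poly_eq0 => /eqP q0.
    by move: qx; rewrite q0 horner0 => /esym/eqP; rewrite oner_eq0.
  (* Multiplied by x^n, the relation 1 = q'(x^-1) expresses (1 - q'_0) x^n by lower powers of x, q'
     having degree at most n. Substituting this for the leading term of [q] gives [q2]. *)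
  pose c := q`_n * u.
  pose q2 := \poly_(i < n) q`_i + \poly_(i < n) (c * q'`_(n - i)).
  apply: (IH x q2 q') => //.
  - move=> i; rewrite coefD !coef_poly.
    have I0 := ideal_span0 R m.
    by case: ifP => _; rewrite ?addr0 //; apply: ideal_span_add => //;
       rewrite mulrC; apply: IM => //; apply: subring_predM => //; exact: IR.
  - rewrite hornerD !horner_poly.
    have -> : \sum_(i < n) c * q'`_(n - i) * x ^+ i = q`_n * x ^+ n.
      have q'E : q'.[x^-1] = \sum_(i < n.+1) q'`_i * x^-1 ^+ i.
        by rewrite (horner_coef_wide _ szqq').
      have -> : q`_n * x ^+ n = c * ((1 - q'`_0) * x ^+ n).
        by rewrite /c /u mulrA mulfVK.
      rewrite -q'x q'E big_ord_recl /= expr0 mulr1 addrC addKr mulr_suml mulr_sumr.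
      rewrite (reindex_inj rev_ord_inj) /=; apply: eq_bigr => i _.
      rewrite -!mulrA /bump /= add1n subKn //; congr (_ * _); congr (_ * _).
      rewrite expfB_cond ?(negPf x0) ?add0n ?ltn_ord // exprVn. by congr (_ * _); rewrite mulrC.
    by rewrite -qx (horner_coef_wide _ (leqnn _)) szq big_ord_recr.
  move: szN; rewrite addSn ltnS; apply: leq_trans; rewrite leq_add2r.
  rewrite (leq_trans (size_polyD _ _)) // geq_max !size_poly //.
exists R; split=> //.
- split=> // x x0; have [|Rx] := boolp.pselect (R x); first by left.
  have [|Rx'] := boolp.pselect (R x^-1); first by right.
  have [q Iq qx] := extend _ Rx; have [q' Iq' q'x] := extend _ Rx'.
  by case: (shorten _ x q q' x0 Iq Iq' qx q'x (leqnn _)).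
move=> x mx; have [->|x0] := eqVneq x 0; first by left.
right=> Rx'; apply: Rm; rewrite -(mulfV x0) -[x * _]addr0.
by apply: ideal_spanD => //; exact: ideal_span0.
Qed.

End Chevalley.

(** * Galois invariance over a henselian valuation ring *)

(** The maximal ideal, or the nonunits of a mere subring; 0 needs its own clause because [0^-1 = 0]
    belongs to [V]. *)
Definition val_max (M : fieldType) (V : M -> Prop) (x : M) : Prop :=
  V x /\ (x = 0 \/ ~ V x^-1).

Lemma val_max_mul (M : fieldType) (R : M -> Prop) x y :
  subring_pred R -> val_max R x -> R y -> val_max R (x * y).
Proof.
move=> hR [Rx hx] Ry; split; first exact: subring_predM.
have [->|x0] := eqVneq x 0; first by left; rewrite mul0r.
have [->|y0] := eqVneq y 0; first by left; rewrite mulr0.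
right=> h; case: hx => [/eqP|]; first by rewrite (negPf x0).
by case; have := subring_predM hR h Ry; rewrite invfM mulfVK.
Qed.

(** * Ultrametric calculus in a valuation ring *)

Section Valuation.
Variables (M : fieldType) (V : M -> Prop) (hV : valuation_ring V).
Implicit Types x y z : M.
Let hS : subring_pred V := proj1 hV.

(** No value group is formed: [V (x / y)] stands for v(x) >= v(y). As [x / 0 = 0], it also holds for
    y = 0, so that nonvanishing has to be carried along. *)
Lemma val_total x y : x != 0 -> y != 0 -> V (x / y) \/ V (y / x).
Proof.
move=> x0 y0; have [|h|h] := (proj2 hV) (x / y); [|by left|right].
  by rewrite mulf_neq0 ?invr_eq0.
by rewrite invfM invrK mulrC in h.
Qed.

Lemma val_trans y x z : y != 0 -> V (x / y) -> V (y / z) -> V (x / z).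
Proof. by move=> y0 h1 h2; have := subring_predM hS h1 h2; rewrite mulrA mulfVK. Qed.

Lemma val_maxV x : val_max V x -> V x. Proof. by case. Qed.

Lemma val_max0 : val_max V 0.
Proof. by split; [exact: subring_pred0 | left]. Qed.

Lemma val_max1 : ~ val_max V 1.
Proof.
case=> _ [/eqP|]; first by rewrite oner_eq0.
by case; rewrite invr1; exact: subring_pred1.
Qed.

Lemma val_not_max x : V x -> ~ val_max V x -> x != 0 /\ V x^-1.
Proof.
move=> Vx nx; have [x0|x0] := eqVneq x 0; first by case: nx; split=> //; left.
by split=> //; apply: boolp.contrapT => h; apply: nx; split=> //; right.
Qed.

Lemma val_not_inv x : x != 0 -> ~ V x -> val_max V x^-1.
Proof.
move=> x0 nx; split; last by right; rewrite invrK.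
by have [] := (proj2 hV) x x0.
Qed.

Lemma val_max_opp x : val_max V x -> val_max V (- x).
Proof.
move=> h; rewrite -mulrN1; apply: val_max_mul => //.
by apply: subring_predN => //; exact: subring_pred1.
Qed.

Lemma val_max_add x y : val_max V x -> val_max V y -> val_max V (x + y).
Proof.
move=> hx hy.
have [->|x0] := eqVneq x 0; first by rewrite add0r.
have [->|y0] := eqVneq y 0; first by rewrite addr0.
have [h|h] := val_total x0 y0.
  have -> : x + y = y * (1 + x / y) by rewrite mulrDr mulr1 mulrCA mulfV // mulr1 addrC.
  by apply: val_max_mul => //; apply: subring_predD => //; exact: subring_pred1.
have -> : x + y = x * (1 + y / x) by rewrite mulrDr mulr1 mulrCA mulfV // mulr1.
by apply: val_max_mul => //; apply: subring_predD => //; exact: subring_pred1.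
Qed.

Lemma val_max_sum T (s : seq T) (P : pred T) F :
  (forall i, P i -> val_max V (F i)) -> val_max V (\sum_(i <- s | P i) F i).
Proof. by move=> h; elim/big_ind: _ => //; [exact: val_max0 | exact: val_max_add]. Qed.

Lemma val_max_prime x y : V x -> V y -> val_max V (x * y) -> val_max V x \/ val_max V y.
Proof.
move=> Vx Vy h; have [|nx] := boolp.pselect (val_max V x); [by left | right].
have [x0 Vx'] := val_not_max Vx nx.
by rewrite -[y](mulKf x0) mulrC; apply: val_max_mul.
Qed.

Lemma val_max_prod (T : eqType) (s : seq T) (P : pred T) F :
  (forall i, P i -> V (F i)) -> val_max V (\prod_(i <- s | P i) F i) ->
  exists i, [/\ i \in s, P i & val_max V (F i)].
Proof.
move=> VF; elim: s => [|a s IH]; first by rewrite big_nil => /val_max1.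
rewrite big_cons; case Pa : (P a); last first.
  by move=> /IH[i [si Pi hi]]; exists i; rewrite inE si orbT.
case/val_max_prime; [exact: VF | exact: subring_pred_prod | |].
  by move=> h; exists a; rewrite inE eqxx.
by move=> /IH[i [si Pi hi]]; exists i; rewrite inE si orbT.
Qed.

Lemma val_max_prod_mem (T : finType) (S : {set T}) F a :
  a \in S -> (forall i, V (F i)) -> val_max V (F a) -> val_max V (\prod_(i in S) F i).
Proof.
move=> Sa VF h; rewrite (bigD1 a) //=; apply: val_max_mul => //.
exact: subring_pred_prod.
Qed.

Lemma val_max_add1 x : val_max V (x - 1) -> x != 0 /\ V x^-1.
Proof.
move=> h; have Vx : V x by rewrite -[x](subrK 1); apply: subring_predD (val_maxV h) (subring_pred1 hS).
apply: val_not_max => // hx; apply: val_max1.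
by rewrite -[1](subKr x); apply: val_max_add => //; exact: val_max_opp.
Qed.

(** The simplest case of integral closedness: if x^-1 is in [V], so is x = x^n (x^-1)^(n-1). *)
Lemma val_root x n : (0 < n)%N -> V (x ^+ n) -> V x.
Proof.
case: n => // n _ h; have [->|x0] := eqVneq x 0; first exact: subring_pred0.
case: ((proj2 hV) x x0) => // h'.
have := subring_predM hS h (subring_predX hS n h').
by rewrite exprS exprVn -mulrA mulfV ?mulr1 // expf_neq0.
Qed.

Lemma val_min (T : eqType) (s : seq T) (F : T -> M) :
  s != [::] -> (forall i, i \in s -> F i != 0) ->
  exists2 i, i \in s & forall j, j \in s -> V (F j / F i).
Proof.
have V1 (x : M) : x != 0 -> V (x / x) by move=> x0; rewrite mulfV //; exact: subring_pred1.
elim: s => // a [|b s] IH _ F0.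
  exists a; rewrite ?inE // => j; rewrite inE => /eqP ->.
  by apply: V1; apply: F0; rewrite inE.
have {}F0 : forall i, i \in a :: b :: s -> F i != 0 := F0.
have [//|i hi|i si hmin] := IH; first by apply: F0; rewrite inE hi orbT.
have a0 : F a != 0 by apply: F0; rewrite inE eqxx.
have i0 : F i != 0 by apply: F0; rewrite inE si orbT.
have [h|h] := val_total a0 i0.
  exists i; first by rewrite inE si orbT.
  by move=> j; rewrite inE => /orP[/eqP ->|/hmin].
exists a; first by rewrite inE eqxx.
move=> j; rewrite inE => /orP[/eqP ->|/hmin hj]; first exact: V1.
exact: val_trans hj h.
Qed.

End Valuation.

(** [henselian] speaks of polynomials over the ambient field; this form fits the polynomial over the
    base field that Galois descent produces in [val_gal_unit]. *)
Definition hensel (F : fieldType) (A : F -> Prop) : Prop :=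
  forall (f : {poly F}) (a : F),
    f \is monic -> (forall i, A f`_i) -> A a ->
    val_max A f.[a] -> ~ val_max A (f^`()).[a] ->
    exists b, [/\ A b, f.[b] = 0 & val_max A (b - a)].

Section Invariance.
Variables (F0 : fieldType) (A0 : F0 -> Prop) (M : splittingFieldType F0).
Variables (V : M -> Prop).
Hypotheses (galoisM : galois 1 {:M}) (hA0 : hensel A0) (hV : valuation_ring V).
Hypothesis VA0 : forall k, V k%:A <-> A0 k.
Let hS : subring_pred V := proj1 hV.

Lemma val_max_alg k : val_max V k%:A <-> val_max A0 k.
Proof.
have E : (k%:A : M)^-1 = (k^-1)%:A by exact/esym/(fmorphV (in_alg M)).
rewrite /val_max E !VA0; split=> -[h1 h2]; split=> //.
  by case: h2 => [/eqP|]; [rewrite scaler_eq0 oner_eq0 orbF => /eqP; left | right].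
by case: h2 => [->|]; [left; rewrite scale0r | right].
Qed.

Lemma gal_fixed_alg (x : M) : (forall g : gal_of {:M}, g x = x) -> exists k, x = k%:A.
Proof.
move=> h; apply/vlineP; rewrite -(galois_fixedField galoisM).
by apply/fixedFieldP; rewrite ?memvf.
Qed.

Lemma gal_fixed_poly (f : {poly M}) :
  (forall g : gal_of {:M}, map_poly g f = f) -> exists f0, f = map_poly (in_alg M) f0.
Proof.
move=> h; apply/polyOver1P/polyOverP => i.
have [|k ->] := @gal_fixed_alg f`_i; last by rewrite memvZ ?mem1v.
by move=> g; rewrite -{2}(h g) coef_map.
Qed.

(* Let S0 be the set of the g with v(g x) minimal, r = #|S0|.  Among the products
   x_S of the g x, g in S, over the S of size r, x_S0 is the only one of minimal
   value, so that the polynomial with roots x_S / t0, t0 = \sum_S x_S, has 1 as a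
   simple residual root.  By Hensel x_S0 is in F0, so S0 is stable under
   translations. *)
Lemma val_gal_unit (x : M) (g : gal_of {:M}) : x != 0 -> V (g x / x).
Proof.
move=> x0.
have gx0 (h : gal_of {:M}) : h x != 0 by rewrite fmorph_eq0.
have [|h _|g0 _ ming0] := @val_min M V hV _ (enum {: gal_of {:M}}) (fun g => g x).
- by apply/eqP => E; have := mem_enum {: gal_of {:M}} 1%g; rewrite E.
- exact: gx0.
pose y (h : gal_of {:M}) := h x / g0 x.
have Vy h : V (y h) by apply: ming0; rewrite mem_enum.
pose S0 := [set h | boolp.asbool (~ val_max V (y h))].
have g0S0 : g0 \in S0.
  rewrite inE; apply/boolp.asboolP; rewrite /y mulfV //; exact: val_max1.
pose r := #|S0|.
pose X (S : {set gal_of {:M}}) := \prod_(h in S) h x.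
pose Y (S : {set gal_of {:M}}) := \prod_(h in S) y h.
have VY S : V (Y S) by apply: subring_pred_prod.
have XY (S : {set gal_of {:M}}) : #|S| = r -> X S = Y S * g0 x ^+ r.
  move=> <-; rewrite /Y /y big_split /= prodr_const exprVn mulfVK //.
  by rewrite expf_neq0.
have [YS00 VYS0] : Y S0 != 0 /\ V (Y S0)^-1.
  apply: val_not_max => // /(val_max_prod hV)[h _|i [_]]; first exact: Vy.
  by rewrite inE => /boolp.asboolP.
have X0 (S : {set gal_of {:M}}) : X S != 0 by apply/prodf_neq0.
pose w S := X S / X S0.
have wE (S : {set gal_of {:M}}) : #|S| = r -> w S = Y S / Y S0.
  move=> Sr; rewrite /w !XY // invfM mulrACA mulfV ?mulr1 //.
  by rewrite expf_neq0.
have Vw (S : {set gal_of {:M}}) : #|S| = r -> V (w S) by move=> /wE ->; apply: subring_predM.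
have maxw (S : {set gal_of {:M}}) : #|S| = r -> S != S0 -> val_max V (w S).
  move=> Sr neq; rewrite wE //; apply: val_max_mul => //.
  have /subsetPn[h hS' hS0] : ~~ (S \subset S0).
    by apply: contra neq => sub; rewrite eqEcard sub Sr leqnn.
  apply: (val_max_prod_mem hV hS') => //.
  by move: hS0; rewrite inE => /boolp.asboolPn/boolp.contrapT.
have actX S (h : gal_of {:M}) : h (X S) = X (S :* h)%g.
  rewrite /X rmorph_prod /= [RHS](reindex_inj (mulIg h)) /=.
  apply: eq_big => [k|k _]; first by rewrite mem_rcoset mulgK.
  by rewrite galM ?memvf.
pose t0 := \sum_(S : {set gal_of {:M}} | #|S| == r) X S.
have fixt0 (h : gal_of {:M}) : h t0 = t0.
  rewrite rmorph_sum /= [RHS](reindex_inj (@rcoset_inj _ h)).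
  by apply: eq_big => [S|S _]; rewrite ?card_rcoset ?actX.
have maxt0 : val_max V (t0 / X S0 - 1).
  rewrite /t0 (bigD1 S0) //= mulrDl mulfV // [1 + _]addrC addrK mulr_suml.
  by apply: val_max_sum => // S /andP[/eqP Sr neq]; exact: maxw.
have [t00 Vt0] := val_max_add1 hV maxt0.
have {}t00 : t0 != 0 by apply: contraNneq t00 => ->; rewrite mul0r.
pose c S := X S / t0.
have cE (S : {set gal_of {:M}}) : c S = w S * (t0 / X S0)^-1.
  by rewrite /c /w invfM invrK mulrC mulrACA mulVf // mulr1 mulrC.
have Vc (S : {set gal_of {:M}}) : #|S| = r -> V (c S) by move=> Sr; rewrite cE; apply: subring_predM => //; exact: Vw.
have maxc (S : {set gal_of {:M}}) : #|S| = r -> S != S0 -> val_max V (c S).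
  by move=> Sr neq; rewrite cE; apply: val_max_mul => //; exact: maxw.
have cS0 : val_max V (1 - c S0).
  rewrite cE /w mulfV // mul1r.
  rewrite -[1](mulfV (x := t0 / X S0)); last by rewrite mulf_neq0 ?invr_eq0.
  by rewrite -[X in _ - X]mul1r -mulrBl; apply: val_max_mul.
have Vpoly (T : finType) (P : pred T) (d : T -> M) :
    (forall i, P i -> V (d i)) -> forall k, V (\prod_(i | P i) ('X - (d i)%:P))`_k.
  move=> Vd; elim/big_ind: _ => [k|p q hp hq k|i Pi k].
  - by rewrite coef1; exact: subring_pred_nat.
  - by rewrite coefM; apply: subring_pred_sum => // j _; exact: subring_predM.
  rewrite coefB coefX coefC; apply: subring_predB => //; first exact: subring_pred_nat.
  by case: ifP => _; [exact: Vd | exact: subring_pred0].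
pose f := \prod_(S : {set gal_of {:M}} | #|S| == r) ('X - (c S)%:P).
have mapXC (h : gal_of {:M}) a : map_poly h ('X - a%:P) = 'X - (h a)%:P.
  by rewrite rmorphB /= map_polyX map_polyC.
have [h|f0 Df] := @gal_fixed_poly f.
  rewrite /f rmorph_prod /= [RHS](reindex_inj (@rcoset_inj _ h)).
  apply: eq_big => [S|S _]; first by rewrite card_rcoset.
  by rewrite mapXC /c fmorph_div /= actX fixt0.
have f1 : val_max A0 f0.[1].
  apply/val_max_alg; have -> : f0.[1]%:A = f.[1].
    by have := horner_map (in_alg M) f0 1; rewrite /= scale1r -Df.
  rewrite /f horner_prod (bigD1 S0) //=; apply: val_max_mul => //.
    by rewrite !hornerE.
  apply: subring_pred_prod => // S /andP[/eqP Sr _]; rewrite !hornerE.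
  by apply: (subring_predB hS (subring_pred1 hS)); exact: Vc.
have f'1 : ~ val_max A0 f0^`().[1].
  move/val_max_alg; have -> : f0^`().[1]%:A = f^`().[1].
    by have := horner_map (in_alg M) f0^`() 1; rewrite /= scale1r -deriv_map -Df.
  rewrite /f (bigD1 S0) //= derivM derivXsubC mul1r.
  set Q := \prod_(S | _) _; rewrite hornerD hornerM => h.
  have VQ k : V Q`_k by apply: Vpoly => S /andP[/eqP Sr _]; exact: Vc.
  have : val_max V Q.[1].
    rewrite -[Q.[1]](addrK (('X - (c S0)%:P).[1] * Q^`().[1])).
    apply: val_max_add => //; apply: val_max_opp => //; apply: val_max_mul => //.
      by rewrite !hornerE.
    rewrite horner_coef; apply: subring_pred_sum => // i _; rewrite expr1n mulr1 coef_deriv.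
    by rewrite -mulr_natr; apply: subring_predM => //; exact: subring_pred_nat.
  rewrite horner_prod => /(val_max_prod hV)[S /andP[/eqP Sr _]|S [_ /andP[/eqP Sr neq]]].
    by rewrite !hornerE; apply: (subring_predB hS (subring_pred1 hS)); exact: Vc.
  rewrite !hornerE => hS1; apply: (@val_max1 M V hV).
  by rewrite -[1](subrK (c S)); apply: val_max_add => //; exact: maxc.
have [|||b [Ab fb0 b1]] := @hA0 f0 1 _ _ _ f1 f'1.
- rewrite -(map_monic (in_alg M)) -Df; exact: monic_prod_XsubC.
- move=> i; apply/VA0; have -> : (f0`_i)%:A = f`_i by rewrite Df coef_map.
  by apply: Vpoly => S /eqP; exact: Vc.
- by apply/VA0; rewrite scale1r; exact: subring_pred1.
have fb : f.[b%:A] = 0 by have := horner_map (in_alg M) f0 b; rewrite /= -Df fb0 scale0r.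
have [S Sr bS] : exists2 S : {set gal_of {:M}}, #|S| = r & b%:A = c S.
  move/eqP: fb; rewrite /f horner_prod => /prodf_eq0[S /eqP Sr].
  by rewrite !hornerE subr_eq0 => /eqP ->; exists S.
(* The root found is congruent to 1, while every [c S] with S other than S0 lies in the maximal
   ideal. *)
have SS0 : S = S0.
  apply/eqP/negPn/negP => neq; apply: (@val_max1 M V hV).
  rewrite -[1](subKr b%:A); apply: val_max_add => //.
    by rewrite bS; apply: maxc.
  apply: val_max_opp => //.
  have -> : b%:A - 1 = (b - 1)%:A :> M by rewrite scalerBl scale1r.
  exact/val_max_alg.
have fixX (h : gal_of {:M}) : X (S0 :* h)%g = X S0.
  have XE : X S0 = b%:A * t0 by rewrite bS SS0 /c mulfVK.
  by rewrite -actX XE rmorphM /= fixt0 rmorph_alg.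
have fixS0 (h : gal_of {:M}) : (S0 :* h)%g = S0.
  apply/eqP/negPn/negP => neq; apply: (@val_max1 M V hV).
  have := maxw (S0 :* h)%g; rewrite card_rcoset => /(_ erefl neq).
  by rewrite /w fixX mulfV.
have allS0 h : h \in S0 by rewrite -(fixS0 (g0^-1 * h)%g) mem_rcoset invMg invgK mulKVg.
have [y0 Vy1] : y 1%g != 0 /\ V (y 1%g)^-1.
  by apply: val_not_max => //; apply/boolp.asboolP; have := allS0 1%g; rewrite inE.
have -> : g x / x = y g * (y 1%g)^-1.
  by rewrite /y gal_id invf_div mulrA mulfVK.
exact: subring_predM.
Qed.

(** An element of [gal_of E] coerces to an automorphism of the whole field, so this form covers the
    Galois groups of all intermediate fields. *)
Lemma val_AEnd (x : M) (phi : 'AEnd(M)) : x != 0 -> V (phi x / x).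
Proof.
move=> x0; have := val_gal_unit (gal {:M} phi) x0.
by rewrite galK ?memvf ?subvf.
Qed.

End Invariance.

(** * Splitting extensions *)

Lemma irreducible_divisor (F : fieldType) (p : {poly F}) :
  (1 < size p)%N -> exists2 r, irreducible_poly r & r %| p.
Proof.
elim: {p}(size p) {-2}p (leqnn (size p)) => [|n IH] p; first by rewrite leqn0 => /eqP ->.
move=> szp p1; have [irr|] := boolp.pselect (irreducible_poly p); first by exists p.
move=> nirr; have [q [q1 qp nq]] : exists q : {poly F}, [/\ size q != 1%N, q %| p & ~~ (q %= p)].
  apply: boolp.contrapT => h; apply: nirr; split=> // q q1 qp.
  by apply: boolp.contrapT => /negP nq; apply: h; exists q.
have p0 : p != 0 by rewrite -size_poly_gt0 ltnW.
have q0 : q != 0 by apply: dvdpN0 p0.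
have szq : (size q < size p)%N.
  by rewrite ltn_neqAle dvdp_leq // andbT dvdp_size_eqp.
have [||r ir rq] := IH q.
- by rewrite -ltnS (leq_trans szq).
- by rewrite ltn_neqAle eq_sym q1 size_poly_gt0.
by exists r => //; apply: dvdp_trans rq qp.
Qed.

Lemma splitting_fieldExt (F : fieldType) (p : {poly F}) : p != 0 ->
  exists (L : fieldExtType F) (rs : seq L),
    map_poly (in_alg L) p %= \prod_(x <- rs) ('X - x%:P).
Proof.
move: {2}(size p) (leqnn (size p)) => n; elim: n F p => [|n IH] F p.
  by rewrite leqn0 size_poly_eq0 => ->.
move=> szp p0; have [p1|p1] := leqP (size p) 1.
  exists F^o, [::]; rewrite big_nil -size_poly_eq1 size_map_poly eqn_leq p1.
  by rewrite size_poly_gt0.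
have [r irr rp] := irreducible_divisor p1.
have [K _ [x rx _]] := irredp_FAdjoin irr.
have px : root (map_poly (in_alg K) p) x by rewrite -(divpK rp) rmorphM rootM rx orbT.
have /factor_theorem[q Dp] := px.
have pK0 : map_poly (in_alg K) p != 0 by rewrite map_poly_eq0.
have q0 : q != 0 by apply: contraNneq pK0 => q0; rewrite Dp q0 mul0r.
have szq : (size q <= n)%N.
  by rewrite -ltnS (leq_trans _ szp) // -(size_map_poly (in_alg K)) Dp size_Mmonic ?monicXsubC // size_XsubC addn2.
have [L [rs Dq]] := IH K q szq q0.
exists (baseFieldType L), (x%:A :: rs).
have -> : map_poly (in_alg (baseFieldType L)) p = map_poly (in_alg L) (map_poly (in_alg K) p).
  by rewrite -map_poly_comp; apply: eq_map_poly => y /=; rewrite baseField_scaleE.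
rewrite Dp rmorphM /= rmorphB /= map_polyX map_polyC big_cons mulrC.
by rewrite eqp_mul2l ?polyXsubC_eq0.
Qed.

Section Tower.
Variables (F0 : fieldType) (F : fieldExtType F0) (L : fieldExtType F).

(** The structure map of [L], retyped so that its target is an extension of [F0]; in this form it is
    [F0]-linear. *)
Definition tower_alg (x : F) : baseFieldType L := x%:A.

Fact tower_alg_zmod : zmod_morphism tower_alg.
Proof. exact: (raddfB (in_alg L)). Qed.
Fact tower_alg_monoid : monoid_morphism tower_alg.
Proof. by split; [exact: (rmorph1 (in_alg L)) | exact: (rmorphM (in_alg L))]. Qed.
Fact tower_alg_scalable : scalable tower_alg.
Proof.
by move=> a u; rewrite baseField_scaleE /tower_alg scalerA mulr_algl.
Qed.

HB.instance Definition _ :=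
  GRing.isZmodMorphism.Build F (baseFieldType L) tower_alg tower_alg_zmod.
HB.instance Definition _ :=
  GRing.isMonoidMorphism.Build F (baseFieldType L) tower_alg tower_alg_monoid.
HB.instance Definition _ :=
  GRing.isScalable.Build F0 F (baseFieldType L) *:%R tower_alg tower_alg_scalable.

End Tower.

Lemma map_XsubC (R S : nzRingType) (h : {rmorphism R -> S}) x :
  map_poly h ('X - x%:P) = 'X - (h x)%:P.
Proof. by rewrite rmorphB /= map_polyX map_polyC. Qed.

Lemma map_prod_XsubC (R S : nzRingType) (h : {rmorphism R -> S}) (s : seq R) :
  map_poly h (\prod_(x <- s) ('X - x%:P)) = \prod_(x <- map h s) ('X - x%:P).
Proof.
by rewrite rmorph_prod big_map; apply: eq_bigr => x _; exact: map_XsubC.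
Qed.

(** [M] must be normal over [F0] for [val_gal_unit] to apply to it. So what is split is not f but
    its norm [Nf], which descends to [F0], together with the polynomial whose roots generate
    [Om]. *)
Lemma splitting_extension (F0 : fieldType) (Om : splittingFieldType F0) (f : {poly Om}) :
  galois 1 {:Om} -> f != 0 ->
  exists (M : splittingFieldType F0) (iota : 'AHom(Om, M)) (rs : seq M),
    map_poly iota f %= \prod_(x <- rs) ('X - x%:P).
Proof.
move=> galOm f0; have [p0 /polyOver1P[q0 Dp0] [rs0 Drs0 genOm]] := splittingFieldP Om.
pose Nf := \prod_(g : gal_of {:Om}) map_poly g f.
have [g|q1 Dq1] := @gal_fixed_poly _ _ galOm Nf.
  rewrite /Nf rmorph_prod /= [RHS](reindex_inj (mulIg g)) /=; apply: eq_bigr => h _.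
  by rewrite -map_poly_comp; apply: eq_map_poly => x; rewrite /= galM ?memvf.
have Nf0 : Nf != 0 by apply/prodf_neq0 => g _; rewrite map_poly_eq0.
have [L [ys Dys]] := splitting_fieldExt Nf0.
pose N : fieldExtType F0 := baseFieldType L; pose j : Om -> N := @tower_alg _ _ L.
pose zs := map j rs0 ++ ys : seq N.
pose E : {subfield N} := <<1 & zs>>%AS.
pose Mx : fieldExtType F0 := subvs_of E.
pose toN := linfun (vsval : Mx -> N).
have [zM DzM] : exists zM : seq Mx, map toN zM = zs.
  exists (map (vsproj _) zs); rewrite -map_comp map_id_in // => y zs_y.
  by rewrite /= lfunE /= vsprojK ?seqv_sub_adjoin.
have valX (q : {poly F0}) : map_poly toN (map_poly (in_alg Mx) q) = map_poly (in_alg N) q.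
  by rewrite -map_poly_comp; apply: eq_map_poly => x; exact: rmorph_alg.
have jX (q : {poly F0}) : map_poly j (map_poly (in_alg Om) q) = map_poly (in_alg N) q.
  by rewrite -map_poly_comp; apply: eq_map_poly => x; exact: rmorph_alg.
have axM : SplittingField.axiom Mx.
  exists (map_poly (in_alg Mx) (q0 * q1)); first by apply: alg_polyOver.
  exists zM.
    rewrite -(eqp_map toN) map_prod_XsubC DzM valX rmorphM /= -!jX -Dp0 -Dq1.
    rewrite big_cat; apply: eqp_trans (eqp_mull _ Dys); apply: eqp_mulr.
    by rewrite -map_prod_XsubC eqp_map.
  apply/vspaceP=> u; rewrite memvf.
  have : val u \in (toN @: <<1 & zM>>)%VS by rewrite aimg_adjoin_seq aimg1 DzM (valP u).
  by case/memv_imgP=> v zv; rewrite lfunE => /val_inj ->.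
pose M : splittingFieldType F0 := HB.pack_for (splittingFieldType F0) Mx
  (FieldExt_isSplittingField.Build F0 Mx axM).
have jE x : j x \in E.
  have : linfun j x \in (linfun j @: {:Om})%VS by rewrite memv_img ?memvf.
  rewrite -genOm aimg_adjoin_seq aimg1 lfunE /=; apply/subvP.
  apply/Fadjoin_seqP; split; first exact: sub1v.
  move=> _ /mapP[y ys0 ->]; apply: seqv_sub_adjoin; rewrite mem_cat lfunE /=.
  by rewrite map_f.
pose i0 : Om -> M := fun x => vsproj E (j x).
have i0K x : vsval (i0 x) = j x by rewrite vsprojK.
have i0l : linear i0.
  move=> a x y; apply: val_inj; rewrite [LHS]i0K.
  have -> : val (a *: i0 x + i0 y) = a *: j x + j y by rewrite linearP /= !i0K.
  exact: (linearP (@tower_alg _ _ L)).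
pose i1 : {linear Om -> M} := HB.pack_for {linear Om -> M} i0
  (GRing.isLinear.Build F0 Om M *:%R i0 i0l).
have i1h : ahom_in {:Om} (linfun i1).
  apply/ahom_inP; split=> [x y _ _|]; rewrite !lfunE /=; apply: val_inj => /=.
    by rewrite !i0K; exact: (rmorphM (@tower_alg _ _ L)).
  by rewrite !i0K algid1; exact: (rmorph1 (@tower_alg _ _ L)).
pose iota := AHom i1h; exists M, iota.
have /dvdp_prod_XsubC[m Dm] : map_poly iota f %| \prod_(x <- zM) ('X - x%:P).
  apply: dvdp_trans (_ : map_poly iota Nf %| _).
    have E1 : map_poly (1%g : gal_of {:Om}) f = f.
      by apply: map_poly_id => x _; rewrite gal_id.
    by rewrite dvdp_map /Nf (bigD1 1%g) //= E1 dvdp_mulr.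
  rewrite -(dvdp_map toN) map_prod_XsubC DzM.
  have -> : map_poly toN (map_poly iota Nf) = map_poly j Nf.
    rewrite -map_poly_comp; apply: eq_map_poly => x; rewrite /= lfunE /=.
    by rewrite (lfunE i1) -[RHS]i0K.
  by rewrite big_cat /= (eqp_dvdl _ Dys) dvdp_mull.
by exists (mask m zM).
Qed.

(** * Approximating Kummer generators *)

(** Chevalley's theorem for m the nonunits of [R]: an x of [E] outside [R] has x^-1 in m, which
    keeps x out of [W]. It serves to pass from L to Om and from Om to the field of the roots. *)
Lemma val_extension (M : fieldType) (E R : M -> Prop) :
  subring_pred R -> (forall x, R x -> E x) -> (forall x y, E x -> E y -> E (x / y)) ->
  (forall x, E x -> x != 0 -> R x \/ R x^-1) ->
  exists2 W, valuation_ring W & forall x, E x -> (W x <-> R x).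
Proof.
move=> hR RE Ediv Etot.
have maxD x y : val_max R x -> val_max R y -> val_max R (x + y).
  move=> hx hy.
  have [->|x0] := eqVneq x 0; first by rewrite add0r.
  have [->|y0] := eqVneq y 0; first by rewrite addr0.
  have [Ex Ey] : E x /\ E y by split; apply: RE; [case: hx | case: hy].
  have [||h|h] := Etot (x / y); first exact: Ediv; first by rewrite mulf_neq0 ?invr_eq0.
    have -> : x + y = y * (1 + x / y) by rewrite mulrDr mulr1 mulrCA mulfV // mulr1 addrC.
    by apply: val_max_mul => //; apply: subring_predD => //; exact: subring_pred1.
  have -> : x + y = x * (1 + y / x) by rewrite mulrDr mulr1 mulrCA mulfV // mulr1.
  rewrite invf_div in h.
  by apply: val_max_mul => //; apply: subring_predD => //; exact: subring_pred1.
have [||W [hW RW mW]] := @chevalley M R (val_max R) hR; first by move=> a [].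
  have : forall x, ideal_span R (val_max R) x -> val_max R x.
    move=> x; elim=> [|a r {}x ma Rr _ hx]; first by split; [exact: subring_pred0 | left].
    by apply: maxD => //; exact: val_max_mul.
  move=> h /h [_ [/eqP|]]; first by rewrite oner_eq0.
  by case; rewrite invr1; exact: subring_pred1.
exists W => // x Ex; split; last exact: RW.
move=> Wx; have [->|x0] := eqVneq x 0; first exact: subring_pred0.
case: (Etot x Ex x0) => // Rx'.
case: (boolp.pselect (R x)) => // nRx.
have [|/eqP|] := mW x^-1; first by split=> //; right; rewrite invrK.
  by rewrite invr_eq0 (negPf x0).
by rewrite invrK.
Qed.

Lemma galois_pchar0 (F0 : fieldType) (M : splittingFieldType F0) :
  [pchar F0] =i pred0 -> galois 1 {:M}.
Proof.
move=> ch0; apply/and3P; split; first exact: sub1v; last exact: normalFieldf.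
by apply/separableP => x _; apply: pcharf0_separable => q; rewrite pchar_lalg ch0.
Qed.

Section Cauchy.
Variables (F0 : fieldType) (A0 : F0 -> Prop) (Om : splittingFieldType F0) (V : Om -> Prop).
Hypotheses (ch0 : [pchar F0] =i pred0) (hA0 : hensel A0) (hV : valuation_ring V).
Hypothesis VA0 : forall k, V k%:A <-> A0 k.
Variables (p : nat) (K L : {subfield Om}) (a d : Om).
Hypotheses (p_pr : prime p) (Vn : forall n, (0 < n < p)%N -> n%:R != 0 :> Om /\ V n%:R^-1).
Hypotheses (sKL : (K <= L)%VS) (dimL : \dim L = (p * \dim K)%N).
Hypotheses (La : a \in L) (aK : a \notin K).
Hypothesis (Vd : forall k, k \in K -> V (d / (a - k))).

Section InExtension.
Variables (M : splittingFieldType F0) (iota : 'AHom(Om, M)) (W : M -> Prop).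
Hypotheses (hW : valuation_ring W) (WV : forall x, W (iota x) <-> V x).

(** The degree of rho over K divides [L(rho) : L] p and is prime to p, so it cannot drop over L. *)
Lemma adjoin_degree_coprime_ext (rho : M) :
  (adjoin_degree (iota @: K) rho < p)%N ->
  minPoly (iota @: L) rho = minPoly (iota @: K) rho.
Proof.
set n := adjoin_degree _ _ => ltnp.
have dimI (E : {subfield Om}) : \dim (iota @: E) = \dim E.
  by rewrite limg_dim_eq // (eqP (AHom_lker0 iota)) capv0.
have sKL2 : (iota @: K <= iota @: L)%VS by apply: limgS.
have n0 : (0 < n)%N by [].
have dvd_n : (n %| adjoin_degree (iota @: L) rho * p)%N.
  have : (<<iota @: K; rho>> <= <<iota @: L; rho>>)%VS by apply: adjoinSl.
  move/field_dimS; rewrite !dim_Fadjoin !dimI dimL mulnA dvdn_pmul2r ?adim_gt0 //.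
have le_n : (n <= adjoin_degree (iota @: L) rho)%N.
  apply: dvdn_leq => //; rewrite Gauss_dvdl // in dvd_n.
  by rewrite coprime_sym prime_coprime // gtnNdvd.
apply/eqP; rewrite -eqp_monic ?monic_minPoly // -dvdp_size_eqp ?minPolyS //.
rewrite eqn_leq dvdp_leq ?minPolyS ?monic_neq0 ?monic_minPoly //.
by rewrite !size_minPoly ltnS.
Qed.

(* k is the mean of the conjugates of rho over K, which are also its conjugates
   over L because the degree is prime to [L : K] = p; they are all at the same
   distance from a. *)
Lemma root_approx (f : {poly Om}) (rho : M) :
  f \is a polyOver K -> f.[a] != 0 -> (size f <= p)%N -> root (map_poly iota f) rho ->
  exists2 k, k \in K & W ((iota a - iota k) / (iota a - rho)).
Proof.
move=> Kf fa0 szf froot.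
have a_rho : iota a - rho != 0.
  rewrite subr_eq0; apply: contra fa0 => /eqP E.
  by move: froot; rewrite -E fmorph_root.
have f0 : f != 0 by apply: contraNneq fa0 => ->; rewrite horner0.
have Kif : map_poly iota f \is a polyOver (iota @: K)%VS.
  by apply/polyOver_poly => i _; rewrite memv_img // (polyOverP Kf).
set n := adjoin_degree (iota @: K) rho.
have ltnp : (n < p)%N.
  apply: leq_trans szf; rewrite -(size_map_poly iota) -size_minPoly.
  by rewrite dvdp_leq ?map_poly_eq0 // minPoly_dvdp.
have galM : galois (iota @: L) {:M}.
  by apply: galoisS (galois_pchar0 M ch0); rewrite sub1v subvf.
have [r [/subsetP rG _ Dmin]] := galois_factors (subvf _) galM rho (memvf _).
have {}Dmin := etrans (esym (adjoin_degree_coprime_ext ltnp)) Dmin.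
set s := [seq _ | _ <- r] in Dmin.
have szs : size s = n.
  by apply: succn_inj; rewrite -(size_minPoly (iota @: K) rho) Dmin (size_prod_XsubC _ id).
have n0 : (0 < n)%N by [].
have Ksum : \sum_(b <- s) b \in (iota @: K)%VS.
  rewrite -[\sum_(b <- s) b]opprK -coefPn_prod_XsubC ?szs -?lt0n // -Dmin rpredN.
  by apply/polyOverP/minPolyOver.
have /memv_imgP[k1 Kk1 Dk1] := Ksum.
have [n00 Vn1] := Vn (introT andP (conj n0 ltnp)).
have in0 : n%:R != 0 :> M by rewrite -(rmorph_nat iota) fmorph_eq0.
exists (k1 / n%:R); first by rewrite memvM ?memvV ?rpred_nat.
have -> : iota a - iota (k1 / n%:R) = n%:R^-1 * \sum_(b <- s) (iota a - b).
  rewrite sumrB big_const_seq count_predT szs iter_addr_0 Dk1 mulrBr.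
  by rewrite fmorph_div rmorph_nat -[iota a *+ n]mulr_natl mulKf // [_^-1 * _]mulrC.
rewrite -mulrA mulr_suml; apply: (subring_predM (proj1 hW)).
  by rewrite -(rmorph_nat iota) -fmorphV WV.
rewrite big_map; apply: (subring_pred_sum_seq (proj1 hW)) => g gr.
have ga : g (iota a) = iota a.
  by apply: fixed_gal (subvf _) (rG g gr) _; rewrite memv_img.
rewrite -{1}ga -rmorphB /=; apply: (@val_gal_unit _ A0) => //; first exact: galois_pchar0.
by move=> k; rewrite -(rmorph_alg iota) WV.
Qed.

End InExtension.

(** The quotient f(a + d) / f(a) is the product of the 1 + d / (a - rho) over the roots. Among the k
    attached to the roots by [root_approx], one with v(a - k) maximal serves them all: put w = d /
    (a - k), which is in [W] by [Vd]; each factor lies in 1 + w W, hence so does the product. The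
    intended d is (zeta - 1) a, for which a + d is sigma a. *)
Lemma cauchy_estimate (f : {poly Om}) :
  f \is a polyOver K -> f.[a] != 0 -> (size f <= p)%N ->
  exists2 k, k \in K & V ((f.[a + d] / f.[a] - 1) * ((a - k) / d)).
Proof.
move=> Kf fa0 szf.
have f0 : f != 0 by apply: contraNneq fa0 => ->; rewrite horner0.
have [M [iota [rs Df]]] := splitting_extension (galois_pchar0 Om ch0) f0.
have iinj := fmorph_inj iota.
have hS := proj1 hV.
pose im (R : Om -> Prop) (y : M) := exists2 x, R x & y = iota x.
have [||||W hW WV'] := @val_extension M (im (fun=> True)) (im V).
- split.
  + by exists 0; rewrite ?rmorph0 //; exact: subring_pred0.
  + by exists 1; rewrite ?rmorph1 //; exact: subring_pred1.
  move=> _ _ [x Vx ->] [y Vy ->]; split.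
    by exists (x - y); rewrite ?rmorphB //; exact: subring_predB.
  by exists (x * y); rewrite ?rmorphM //; exact: subring_predM.
- by move=> _ [x _ ->]; exists x.
- by move=> _ _ [x _ ->] [y _ ->]; exists (x / y); rewrite ?fmorph_div.
- move=> _ [x _ ->]; rewrite fmorph_eq0 => x0.
  have [h|h] := (proj2 hV) x x0; [left; exists x | right; exists x^-1] => //.
  by rewrite fmorphV.
have WV x : W (iota x) <-> V x.
  split=> [/(WV' _ (ex_intro2 _ _ x I erefl))[y Vy /iinj ->] //|Vx].
  by apply/WV'; exists x.
have hSW := proj1 hW.
have ak k : k \in K -> a - k != 0 by move=> Kk; rewrite subr_eq0; apply: contraNneq aK => ->.
have rsP rho : rho \in rs -> root (map_poly iota f) rho.
  by rewrite (eqp_root Df) root_prod_XsubC.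
have a_rho rho : rho \in rs -> iota a - rho != 0.
  move=> /rsP froot; rewrite subr_eq0; apply: contra fa0 => /eqP E.
  by move: froot; rewrite -E fmorph_root.
have [k Kk kP] : exists2 k, k \in K &
    forall rho, rho \in rs -> W ((iota a - iota k) / (iota a - rho)).
  elim: (rs) rsP a_rho => [|rho s IH] rsP a_rho; first by exists 0; rewrite ?mem0v.
  have [||k1 Kk1 h1] := IH.
  - by move=> r hr; apply: rsP; rewrite inE hr orbT.
  - by move=> r hr; apply: a_rho; rewrite inE hr orbT.
  have [|k2 Kk2 h2] := root_approx hW WV Kf fa0 szf (_ : root _ rho).
    by apply: rsP; rewrite inE eqxx.
  have ik k : k \in K -> iota a - iota k != 0 by move=> Kk; rewrite -rmorphB fmorph_eq0 ak.
  have [h|h] := val_total hW (ik _ Kk1) (ik _ Kk2).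
    exists k1 => // r; rewrite inE => /orP[/eqP ->|]; last exact: h1.
    exact: val_trans (ik _ Kk2) h h2.
  exists k2 => // r; rewrite inE => /orP[/eqP ->//|hr].
  exact: val_trans (ik _ Kk1) h (h1 _ hr).
exists k => //; apply/WV.
pose w := iota d / (iota a - iota k).
have Ww : W w by rewrite /w -rmorphB -fmorph_div WV; exact: Vd.
have [d0|d0] := eqVneq d 0.
  by rewrite d0 invr0 !mulr0 rmorph0; exact: subring_pred0.
have w0 : w != 0 by rewrite mulf_neq0 ?invr_eq0 -?rmorphB ?fmorph_eq0 ?ak.
have -> : iota ((f.[a + d] / f.[a] - 1) * ((a - k) / d)) =
    (\prod_(rho <- rs) (1 + iota d / (iota a - rho)) - 1) / w.
  rewrite rmorphM /=; congr (_ * _); last by rewrite /w invf_div fmorph_div /= rmorphB.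
  rewrite rmorphB rmorph1; congr (_ - 1).
  rewrite fmorph_div /= -!horner_map.
  have [[c1 c2] /andP[c10 c20] Dc] := eqpP _ _ Df.
  have {}Dc : map_poly iota f = (c2 / c1) *: \prod_(x <- rs) ('X - x%:P).
    apply: (scalerI c10); rewrite Dc scalerA mulrCA mulfV // mulr1 //.
  rewrite !Dc !hornerZ -mulf_div mulfV ?mul1r; last by rewrite mulf_neq0 ?invr_eq0.
  rewrite !horner_prod -prodf_div big_seq [RHS]big_seq; apply: eq_bigr => rho hr.
  rewrite !hornerE rmorphD addrAC mulrDl mulfV //; exact: a_rho.
have : forall rho, rho \in rs -> W (iota d / (iota a - rho) / w).
  move=> rho hr; have -> : iota d / (iota a - rho) / w = (iota a - iota k) / (iota a - rho).
    by rewrite /w invf_div mulrAC [iota d * _]mulrC mulfVK ?fmorph_eq0.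
  exact: kP.
elim: (rs) => [|rho s IH] hs.
  by rewrite big_nil subrr mul0r; exact: subring_pred0.
rewrite big_cons [(1 + _) * _]mulrDl mul1r addrAC mulrDl.
have h1 : W ((\prod_(j <- s) (1 + iota d / (iota a - j)) - 1) / w).
  by apply: IH => r hr; apply: hs; rewrite inE hr orbT.
have h2 : W (iota d / (iota a - rho) / w) by apply: hs; rewrite inE eqxx.
apply: subring_predD => //; rewrite mulrAC; apply: subring_predM => //.
rewrite -[\prod_(j <- s) _](subrK 1); apply: subring_predD => //; last exact: subring_pred1.
by rewrite -[_ - 1](mulfVK w0); apply: subring_predM.
Qed.

End Cauchy.

(** * Roots of unity and sums *)

(** If every nonzero summand had larger value than the sum x, then 1, the sum of the F i / x, would
    lie in the maximal ideal. *)
Lemma val_sum_pick (M : fieldType) (V : M -> Prop) (T : eqType) (s : seq T) (F : T -> M) :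
  valuation_ring V -> \sum_(i <- s) F i != 0 ->
  exists i, [/\ i \in s, F i != 0 & V ((\sum_(i <- s) F i) / F i)].
Proof.
move=> hV; set x := \sum_(i <- s) F i => x0.
apply: boolp.contrapT => h; apply: (@val_max1 M V hV).
rewrite -(mulfV x0) {1}/x mulr_suml big_seq; apply: val_max_sum => // i si.
have [->|Fi0] := eqVneq (F i) 0; first by rewrite mul0r; exact: val_max0.
rewrite -invf_div; apply: val_not_inv => //; first by rewrite mulf_neq0 ?invr_eq0.
by move=> Vi; apply: h; exists i.
Qed.

(** Up to sign the coefficient is an elementary symmetric function of degree [size s - i]; writing
    z^i / z^(size s) avoids truncated subtraction. *)
Lemma val_prod_XsubC_coef (M : fieldType) (V : M -> Prop) (z : M) (s : seq M) i :
  subring_pred V -> z != 0 -> (forall x, x \in s -> V (x / z)) ->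
  V ((\prod_(x <- s) ('X - x%:P))`_i * z ^+ i / z ^+ size s).
Proof.
move=> hV z0; elim: s i => [|x s IH] i hs.
  rewrite big_nil coef1 divr1; case: i => [|i] /=.
    by rewrite mulr1; exact: subring_pred1.
  by rewrite mul0r; exact: subring_pred0.
have {}IH j := IH j (fun y sy => hs y (mem_behead (s := x :: s) sy)).
rewrite big_cons mulrBl coefB coefXM coefCM !mulrBl; apply: subring_predB => //.
  case: i => [|i] /=; first by rewrite !mul0r; exact: subring_pred0.
  by rewrite !exprS mulrCA -mulf_div mulfV // mul1r.
have := subring_predM hV (hs x (mem_head _ _)) (IH i).
by rewrite mulf_div -exprS mulrA.
Qed.

Lemma prime_primitive_root (F : fieldType) (p : nat) (x : F) :
  prime p -> x ^+ p = 1 -> x != 1 -> p.-primitive_root x.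
Proof.
move=> p_pr xp x1; have [m mx] := prim_order_exists (prime_gt0 p_pr) xp.
case/primeP: p_pr => _ h /h /orP[/eqP m1|/eqP <-//].
by move: (prim_expr_order mx) x1; rewrite m1 expr1 => ->; rewrite eqxx.
Qed.

Section RootsOfUnity.
Variables (M : fieldType) (V : M -> Prop) (p : nat).
Hypotheses (hV : valuation_ring V) (p_pr : prime p).
Let hS := proj1 hV.

Lemma val_root1 (x : M) : x ^+ p = 1 -> V x.
Proof. by move=> xp; apply: (val_root hV (prime_gt0 p_pr)); rewrite xp; exact: subring_pred1. Qed.

(** With y = x^i the quotient is 1 + x + ... + x^(i-1); it is a cyclotomic unit when y is primitive
    too. *)
Lemma val_prim_root_ratio (x y : M) :
  p.-primitive_root x -> y ^+ p = 1 -> V ((y - 1) / (x - 1)).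
Proof.
move=> px yp; have [i ->] := prim_rootP px yp.
have x1 : x - 1 != 0.
  rewrite subr_eq0 -{1}[x]expr1 -(prim_order_dvd px) dvdn1.
  by rewrite neq_ltn prime_gt1 ?orbT.
rewrite subrX1 mulrC mulKf //; apply: subring_pred_sum => // j _.
by apply: subring_predX => //; apply: val_root1; exact: prim_expr_order.
Qed.

End RootsOfUnity.

(** * The Kummer extension L | K *)

Section KummerTower.
Variables (F0 : fieldType) (Om : splittingFieldType F0) (p : nat).
Variables (L' K L : {subfield Om}) (zeta : Om) (sigma : gal_of L).
Hypotheses (ch0 : [pchar F0] =i pred0) (p_pr : prime p).
Hypotheses (galL' : galois 1 L') (dimL' : \dim L' = p).
Hypotheses (zetaP : p.-primitive_root zeta).
Hypotheses (defK : K = <<1; zeta>>%AS) (defL : L = <<L'; zeta>>%AS).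
Hypothesis defG : ('Gal(L / K) = <[sigma]>)%g.

Lemma zetaK : zeta \in K. Proof. by rewrite defK memv_adjoin. Qed.

Lemma sL'L : (L' <= L)%VS. Proof. by rewrite defL subv_adjoin. Qed.

Lemma sKL : (K <= L)%VS.
Proof. by rewrite defK defL; apply: adjoinSl; exact: sub1v. Qed.

Lemma zeta_neq1 : zeta != 1.
Proof.
rewrite -[zeta]expr1 -(prim_order_dvd zetaP) dvdn1.
by rewrite neq_ltn prime_gt1 ?orbT.
Qed.

Lemma dimK_lt : (\dim K < p)%N.
Proof.
rewrite defK dim_Fadjoin dimv1 muln1.
pose q : {poly Om} := \poly_(i < p) 1.
have qz : root q zeta.
  have z10 : zeta - 1 != 0 by rewrite subr_eq0 zeta_neq1.
  rewrite /root -(mulrI_eq0 _ (mulfI z10)) horner_poly.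
  under eq_bigr do rewrite mul1r.
  by rewrite -subrX1 (prim_expr_order zetaP) subrr.
have q1 : q \is a polyOver 1%VS.
  by apply/polyOverP => i; rewrite coef_poly; case: ifP; rewrite ?mem0v ?mem1v.
have q0 : q != 0.
  apply/eqP => /polyP/(_ 0); rewrite coef_poly coef0 prime_gt0 // => /eqP.
  by rewrite oner_eq0.
have := dvdp_leq q0 (minPoly_dvdp q1 qz).
by rewrite size_minPoly => /leq_trans; apply; rewrite size_poly.
Qed.

Lemma coprime_dimK : coprime (\dim K) p.
Proof. by rewrite coprime_sym prime_coprime // gtnNdvd ?adim_gt0 ?dimK_lt. Qed.

(** The coprime numbers [p] and [\dim K] both divide [\dim L], and the degree of zeta does not grow
    from F0 to L'. *)
Lemma dimL : \dim L = (p * \dim K)%N.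
Proof.
apply/eqP; rewrite eqn_leq; apply/andP; split.
  rewrite defL defK !dim_Fadjoin dimv1 muln1 dimL' mulnC leq_mul2l.
  rewrite -ltnS -!size_minPoly dvdp_leq ?orbT ?minPolyS ?sub1v //.
  by rewrite monic_neq0 ?monic_minPoly.
rewrite dvdn_leq ?adim_gt0 // mulnC Gauss_dvd ?coprime_dimK //.
by have := field_dimS sL'L; rewrite dimL' field_dimS ?sKL.
Qed.

(** The degrees of K and L' are coprime. This is what places the elements of H fixed by Lambda in
    K'. *)
Lemma KL'_alg x : x \in K -> x \in L' -> x \in 1%VS.
Proof.
move=> Kx L'x; have : x \in (K :&: L')%VS by rewrite memv_cap Kx.
have d1 : \dim (K :&: L')%AS = 1%N.
  apply/eqP; rewrite -dvdn1 -(eqP coprime_dimK) dvdn_gcd -dimL'.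
  by rewrite !field_dimS ?capvSl ?capvSr.
suff -> : (K :&: L')%VS = 1%VS by [].
apply/eqP; rewrite eq_sym eqEdim dimv1; apply/andP; split.
  exact: (sub1v (K :&: L')%AS).
by apply: eq_leq; exact: d1.
Qed.

Lemma root1_exp x : x ^+ p = 1 -> exists i : nat, x = zeta ^+ i.
Proof. by move=> xp; have [i ->] := prim_rootP zetaP xp; exists i. Qed.

Lemma AEnd_zeta (phi : 'AEnd(Om)) : exists i : nat, phi zeta = zeta ^+ i.
Proof. by apply: root1_exp; rewrite -rmorphXn (prim_expr_order zetaP) rmorph1. Qed.

Lemma AEnd_L' (phi : 'AEnd(Om)) : (phi @: L' = L')%VS.
Proof.
have /and3P[_ _ /forallP/(_ phi)/implyP h] := galL'.
by apply/eqP/h; rewrite inE kAutfE k1AHom.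
Qed.

Lemma galL : galois 1 L.
Proof.
apply/and3P; split; first exact: sub1v.
  by apply/separableP => x _; apply: pcharf0_separable => q; rewrite pchar_lalg ch0.
apply/forallP => phi; apply/implyP => _.
rewrite eqEdim limg_dim_eq ?(eqP (AHom_lker0 phi)) ?capv0 // leqnn andbT.
rewrite {1}defL aimg_adjoin AEnd_L'; apply/FadjoinP; split; first exact: sL'L.
by have [i ->] := AEnd_zeta phi; rewrite rpredX // (subvP sKL) ?zetaK.
Qed.

Lemma galKL : galois K L.
Proof. by apply: galoisS galL; rewrite sub1v sKL. Qed.

Lemma galL'L : galois L' L.
Proof. by apply: galoisS galL; rewrite sub1v sL'L. Qed.

Lemma sigma_gal : sigma \in 'Gal(L / K)%g.
Proof. by rewrite defG cycle_id. Qed.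

Lemma sigmaK x : x \in K -> sigma x = x.
Proof. by move=> Kx; apply: fixed_gal sKL sigma_gal Kx. Qed.

Lemma sigma_fixed x : x \in L -> sigma x = x -> x \in K.
Proof.
move=> Lx sx; rewrite -(galois_fixedField galKL); apply/fixedFieldP => // g.
rewrite defG => /cycleP[i ->]; elim: i => [|i IH]; first by rewrite gal_id.
by rewrite expgS galM // sx.
Qed.

Lemma sigmaL' x : x \in L' -> sigma x \in L'.
Proof. by move=> L'x; rewrite -(AEnd_L' sigma) memv_img. Qed.

(** It suffices to look at L' and zeta: tau fixes L', which sigma preserves, and sigma fixes the
    powers of zeta. Hence sigma commutes with the trace from L to L'. *)
Lemma sigma_comm tau x : tau \in 'Gal(L / L')%g -> x \in L ->
  sigma (tau x) = tau (sigma x).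
Proof.
move=> tauG; rewrite {1}defL => /Fadjoin_polyP[q L'q ->].
have tq r : r \is a polyOver L' -> map_poly tau r = r.
  by apply: fixedPoly_gal sL'L tauG.
have L'sq : map_poly sigma q \is a polyOver L'.
  by apply/polyOver_poly => i _; apply: sigmaL'; exact: (polyOverP L'q).
rewrite -!horner_map /= tq // tq // [sigma zeta]sigmaK ?zetaK //.
by have [i ->] := AEnd_zeta tau; rewrite sigmaK // rpredX ?zetaK.
Qed.

Lemma kummer_generates a : a \in L -> a \notin K -> <<K; a>>%VS = L.
Proof.
move=> La aK; apply/eqP; rewrite eqEdim; apply/andP; split.
  by apply/FadjoinP; rewrite sKL.
have sub : (<<K; a>> <= L)%VS by apply/FadjoinP; rewrite sKL.
have := field_dimS sub; rewrite dimL dim_Fadjoin dvdn_pmul2r ?adim_gt0 //.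
case/primeP: p_pr => _ h /h /orP[|/eqP ->//].
by rewrite adjoin_deg_eq1 (negPf aK).
Qed.

Lemma kummer_frakA a : a \in L -> a \notin K -> a ^+ p \in K -> frakA p K L (a ^+ p).
Proof. by move=> La aK apK; split=> //; exists a; rewrite kummer_generates. Qed.

Lemma frakA_kummer h : frakA p K L h ->
  exists a xi, [/\ a \in L, a ^+ p = h, a != 0, p.-primitive_root xi & sigma a = xi * a].
Proof.
case=> Kh [a [ap defLa]].
have La : a \in L by rewrite -defLa memv_adjoin.
have aK : a \notin K.
  apply/negP => /Fadjoin_idP E; have := dimL; rewrite -defLa E => /eqP.
  rewrite -{1}[\dim K]mul1n eqn_pmul2r ?adim_gt0 // => /eqP p1.
  by move: p_pr; rewrite -p1.
have a0 : a != 0 by apply: contraNneq aK => ->; rewrite mem0v.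
exists a, (sigma a / a); split=> //; last by rewrite mulfVK.
apply: prime_primitive_root => //.
  by rewrite expr_div_n -rmorphXn /= ap sigmaK // -ap mulfV // expf_neq0.
apply: contra aK => /eqP E; apply: sigma_fixed => //.
by rewrite -[sigma a](mulfVK a0) E mul1r.
Qed.

Lemma kummer_exists : exists a, [/\ a \in L, a != 0 & sigma a = zeta * a].
Proof.
have Lz : zeta \in L by rewrite (subvP sKL) ?zetaK.
have zeta0 : zeta != 0.
  apply: contra_eq_neq (prim_expr_order zetaP) => ->.
  by rewrite expr0n gtn_eqF ?prime_gt0 // eq_sym oner_neq0.
have gen : generator 'Gal(L / K)%g sigma by rewrite /generator defG.
have cardG : #|'Gal(L / K)%g| = p.
  by rewrite -(galois_dim galKL) dimL mulnK ?adim_gt0.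
have Lzi : zeta^-1 \in L by rewrite memvV.
have [|b [Lb b0] E] := elimT (Hilbert's_theorem_90 gen Lzi).
  rewrite /galNorm (eq_bigr (fun=> zeta^-1)) => [|g Gg].
    by rewrite prodr_const cardG exprVn (prim_expr_order zetaP) invr1.
  by rewrite (fixed_gal sKL Gg) // memvV zetaK.
exists b; split=> //; apply: (mulfI (_ : zeta^-1 != 0)); first by rewrite invr_eq0.
by rewrite mulKf // E mulfVK // fmorph_eq0.
Qed.


(** * Values in the Kummer tower *)

Variables (A0 : F0 -> Prop) (V : Om -> Prop).
Hypotheses (hA0 : hensel A0) (hV : valuation_ring V).
Hypothesis VA0 : forall k, V k%:A <-> A0 k.
Let hS : subring_pred V := proj1 hV.

Lemma val_gal (E : {subfield Om}) (g : gal_of E) x : x != 0 -> V (g x / x).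
Proof. by apply: (val_AEnd _ hA0 hV VA0); exact: galois_pchar0. Qed.

(** The automorphisms representing g and g^-1 are inverse to each other on [E] only, whence the
    condition on x. *)
Lemma val_galV (E : {subfield Om}) (g : gal_of E) x : x \in E -> x != 0 -> V (x / g x).
Proof.
move=> Ex x0; have gx0 : g x != 0 by rewrite fmorph_eq0.
have gK : (g^-1)%g (g x) = x by rewrite -galM // mulgV gal_id.
by have := val_gal (g^-1)%g gx0; rewrite gK.
Qed.

Lemma val_zeta_ratio xi : xi ^+ p = 1 -> xi != 1 ->
  V ((xi - 1) / (zeta - 1)) /\ V ((zeta - 1) / (xi - 1)).
Proof.
move=> xip xi1; have xiP := prime_primitive_root p_pr xip xi1.
by split; apply: (val_prim_root_ratio hV p_pr) => //; exact: prim_expr_order.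
Qed.

(** For odd p, a^p - 1 is the norm of a - 1 from L to K, and the p conjugates xi^j a - 1 all have
    the value of a - 1. *)
Lemma kummer_norm a xi : odd p -> a \in L -> a != 0 -> a != 1 ->
  p.-primitive_root xi -> sigma a = xi * a -> xi \in K ->
  V ((a ^+ p - 1) / (a - 1) ^+ p) /\ V ((a - 1) ^+ p / (a ^+ p - 1)).
Proof.
move=> oddp La a0 a1 xiP sa Kxi.
have a10 : a - 1 != 0 by rewrite subr_eq0.
have sj j : (sigma ^+ j)%g a = xi ^+ j * a.
  elim: j => [|j IH]; first by rewrite gal_id mul1r.
  rewrite expgSr galM // IH rmorphM /= sa.
  by rewrite [sigma (_ ^+ _)]sigmaK ?rpredX // mulrA -exprSr.
have sja j : (sigma ^+ j)%g (a - 1) = xi ^+ j * a - 1.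
  by rewrite rmorphB rmorph1 /= sj.
have La1 : a - 1 \in L by rewrite memvB ?mem1v.
have -> : a ^+ p - 1 = \prod_(j < p) (sigma ^+ j)%g (a - 1).
  have := factor_Xn_sub_1 xiP => /(congr1 (fun q => q.[a^-1])).
  rewrite big_mkord horner_prod !hornerE => E.
  rewrite (eq_bigr (fun j : 'I_p => (a^-1 - xi ^+ j) * - a)) => [|j _]; last first.
    by rewrite sja mulrN mulrBl mulVf // opprB.
  rewrite big_split /= prodr_const card_ord.
  rewrite (eq_bigr (fun j : 'I_p => ('X - (xi ^+ j)%:P).[a^-1])) => [|j _]; last by rewrite !hornerE.
  rewrite E exprNn -signr_odd oddp expr1 mulN1r mulrN mulrBl mul1r exprVn.
  by rewrite mulVf ?expf_neq0 // opprB.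
have -> : (a - 1) ^+ p = \prod_(j < p) (a - 1) by rewrite prodr_const card_ord.
split; rewrite -prodf_div; apply: subring_pred_prod => // j _; [exact: val_gal | exact: val_galV].
Qed.

(* With T_i = Tr(z^i (sigma b - b)) for the trace Tr from L to L' and z = zeta - 1,
   partial fractions over the conjugates of z give
   sigma b - b = \sum_i g_i T_i with g_i z^i in V. *)
Lemma descent b : b \in L -> b != 0 -> sigma b / b - 1 != 0 ->
  exists b', [/\ b' \in L', b' != 0, sigma b' / b' - 1 != 0 &
    V ((sigma b / b - 1) / (sigma b' / b' - 1))].
Proof.
move=> Lb b0 c0; pose z := zeta - 1; pose G := 'Gal(L / L')%g.
have z0 : z != 0 by rewrite subr_eq0 zeta_neq1.
have Kz : z \in K by rewrite memvB ?zetaK ?mem1v.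
have Lz : z \in L by rewrite (subvP sKL).
have G1 : 1%g \in G by exact: group1.
pose beta := sigma b - b.
have cE y : y != 0 -> sigma y / y - 1 = (sigma y - y) / y.
  by move=> y0; rewrite mulrBl mulfV.
have beta0 : beta != 0.
  by apply: contraNneq c0 => E; rewrite cE // -/beta E mul0r.
have Lbeta : beta \in L by rewrite memvB ?memv_gal.
(* [P] vanishes at every conjugate of z except z itself. The [g i] are Euler's dual basis of the
   powers of z for the trace form, P(z) being the derivative of (X - z) P at z. *)
pose s := [seq (tau : gal_of L) z | tau <- enum (G :\ 1%g)].
pose P := \prod_(x <- s) ('X - x%:P).
pose g i := P`_i / P.[z].
have szP : size P = (size s).+1 by rewrite (size_prod_XsubC _ id).
(* No other conjugate is closer to z than 0 is; this is the form in which tameness is used. *)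
have tauz (tau : gal_of L) : tau \in G -> tau != 1%g ->
    z - tau z != 0 /\ V (z / (z - tau z)).
  move=> Gtau tau1.
  have tz : tau zeta != zeta.
    apply: contra tau1 => /eqP E; apply/gal_eqP => y; rewrite {1}defL.
    case/Fadjoin_polyP=> q L'q ->; rewrite gal_id -horner_map /= E.
    by rewrite (fixedPoly_gal sL'L Gtau L'q).
  pose xi := tau zeta / zeta.
  have zeta0 : zeta != 0.
    by apply: contraNneq tz => E; rewrite E rmorph0.
  have xi1 : xi != 1 by apply: contra tz => /eqP E; rewrite -[tau zeta](mulfVK zeta0) -/xi E mul1r.
  have xip : xi ^+ p = 1.
    by rewrite expr_div_n -rmorphXn /= (prim_expr_order zetaP) rmorph1 divr1.
  have -> : z - tau z = - (zeta * (xi - 1)).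
    rewrite /z rmorphB rmorph1 /= mulrBr mulr1 /xi [zeta * _]mulrC mulfVK //; ring.
  split; first by rewrite oppr_eq0 mulf_neq0 // subr_eq0.
  have [_ h] := val_zeta_ratio xip xi1.
  rewrite invrN mulrN invfM mulrCA; apply: (subring_predN hS); apply: (subring_predM hS) => //.
  by apply: (val_root1 hV p_pr); rewrite exprVn (prim_expr_order zetaP) invr1.
have Pz : P.[z] = \prod_(x <- s) (z - x).
  by rewrite horner_prod; apply: eq_bigr => x _; rewrite !hornerE.
have sP x : x \in s -> exists tau : gal_of L, [/\ tau \in G, tau != 1%g & x = tau z].
  case/mapP=> tau; rewrite mem_enum !inE => /andP[t1 tG] ->; by exists tau.
have Pz0 : P.[z] != 0.
  rewrite Pz prodf_seq_neq0; apply/allP => x /sP[tau [tG t1 ->]] /=.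
  by have [] := tauz tau tG t1.
have Vg i : V (g i * z ^+ i).
  have -> : g i * z ^+ i = P`_i * z ^+ i / z ^+ size s * (z ^+ size s / P.[z]).
    by rewrite mulrA mulfVK ?expf_neq0 // /g mulrAC.
  apply: (subring_predM hS).
    by apply: val_prod_XsubC_coef => // x /sP[tau [tG t1 ->]]; exact: val_gal.
  have -> : z ^+ size s = \prod_(x <- s) z by rewrite big_const_seq count_predT -Monoid.iteropE.
  rewrite Pz -prodf_div big_seq; apply: (subring_pred_prod hS) => x /sP[tau [tG t1 ->]].
  by have [] := tauz tau tG t1.
have trace_sum : \sum_(i < size P) g i * galTrace L' L (z ^+ i * beta) = beta.
  rewrite (eq_bigr (fun i : 'I_(size P) =>
      \sum_(tau in G) P`_i * tau z ^+ i * (tau beta / P.[z]))) => [|i _]; last first.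
    rewrite /galTrace mulr_sumr; apply: eq_bigr => tau _.
    by rewrite rmorphM rmorphXn /= /g mulrACA -mulrA [_ * tau beta]mulrC -!mulrA.
  rewrite exchange_big /= (eq_bigr (fun tau : gal_of L => P.[tau z] * (tau beta / P.[z]))) => [|tau _].
    rewrite (bigD1 1%g) //= big1 => [|tau /andP[tG t1]].
      by rewrite !gal_id addr0 mulrCA mulfV // mulr1.
    have /rootP -> : root P (tau z).
      by rewrite root_prod_XsubC; apply/mapP; exists tau; rewrite // mem_enum !inE t1.
    by rewrite mul0r.
  by rewrite [P.[tau z]]horner_coef mulr_suml.
have [|i [_ t0 Vt]] := @val_sum_pick _ V _ (index_enum 'I_(size P))
  (fun i => g i * galTrace L' L (z ^+ i * beta)) hV; first by rewrite trace_sum.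
rewrite trace_sum in Vt.
pose b' := galTrace L' L (z ^+ i * b).
have Lzb : z ^+ i * b \in L by rewrite memvM ?rpredX.
have L'b' : b' \in L' by exact: mem_galTrace galL'L Lzb.
have T : sigma b' - b' = galTrace L' L (z ^+ i * beta).
  rewrite /b' /galTrace rmorph_sum -sumrB; apply: eq_bigr => tau tG /=.
  by rewrite sigma_comm // -rmorphB /= rmorphM rmorphXn /= sigmaK // -mulrBr.
move: t0; rewrite mulf_eq0 negb_or -T => /andP[gi0 T0].
have b'0 : b' != 0 by apply: contraNneq T0 => ->; rewrite rmorph0 subrr.
exists b'; split=> //; first by rewrite cE // mulf_neq0 ?invr_eq0.
(* The factors are in [V] by the choice of i, by [Vg], and because b' is a sum of conjugates of z^i
   b, respectively. *)
have -> : (sigma b / b - 1) / (sigma b' / b' - 1) =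
    beta / (g i * (sigma b' - b')) * (g i * z ^+ i * (b' / (z ^+ i * b))).
  have zi0 : z ^+ i != 0 by rewrite expf_neq0.
  by rewrite !cE // -/beta; field; rewrite zi0 gi0 T0 b0 b'0.
apply: (subring_predM hS); first by rewrite T.
apply: (subring_predM hS) => //.
rewrite /b' /galTrace mulr_suml; apply: (subring_pred_sum hS) => tau _; apply: val_gal.
by rewrite mulf_neq0 ?expf_neq0.
Qed.

Lemma root1_K xi : xi ^+ p = 1 -> xi \in K.
Proof. by case/root1_exp=> i ->; rewrite rpredX ?zetaK. Qed.

Lemma frakA_bound h : odd p -> frakA p K L h ->
  exists b, [/\ b \in L', b != 0, sigma b / b - 1 != 0 &
    V ((zeta - 1) ^+ p / (h - 1) / (sigma b / b - 1) ^+ p)].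
Proof.
move=> oddp /frakA_kummer[a [xi [La ap a0 xiP sa]]].
have xip := prim_expr_order xiP.
have xi1 : xi - 1 != 0.
  rewrite subr_eq0 -[xi]expr1 -(prim_order_dvd xiP) dvdn1.
  by rewrite neq_ltn prime_gt1 ?orbT.
have z0 : zeta - 1 != 0 by rewrite subr_eq0 zeta_neq1.
have a10 : a - 1 != 0.
  apply: contra_neq xi1 => /eqP; rewrite subr_eq0 => /eqP a1.
  by move: sa; rewrite a1 rmorph1 mulr1 => <-; rewrite subrr.
have a1 : a != 1 by rewrite -subr_eq0.
have [_ Vh] := kummer_norm oddp La a0 a1 xiP sa (root1_K xip).
rewrite ap in Vh.
have h1 : h - 1 != 0.
  rewrite subr_eq0; apply: contra_neq xi1 => h1; move: ap; rewrite h1 => /root1_K/sigmaK.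
  by rewrite sa -{2}[a]mul1r => /(mulIf a0) ->; rewrite subrr.
have xi1' : xi != 1 by rewrite -subr_eq0.
have [_ Vz] := val_zeta_ratio xip xi1'.
suff [b [Lb b0 c0 Vc]] : exists b, [/\ b \in L, b != 0, sigma b / b - 1 != 0 &
    V ((zeta - 1) ^+ p / (h - 1) / (sigma b / b - 1) ^+ p)].
  have [b' [L'b' b'0 c'0 Vc']] := descent Lb b0 c0.
  exists b'; split=> //; have := subring_predM hS Vc (subring_predX hS p Vc').
  by rewrite expr_div_n mulrA mulfVK // expf_neq0.
(* If v(a - 1) <= 0, then b = a has v(sigma b / b - 1) = v(z) <= v(z) - v(a - 1). Otherwise a is a
   unit and b = a - 1 gives exactly v(z) - v(a - 1). *)
have [Va|Va] := boolp.pselect (V (a - 1)^-1).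
  exists a; have -> : sigma a / a - 1 = xi - 1 by rewrite sa mulfK.
  split=> //; have := subring_predM hS (subring_predM hS (subring_predX hS p Vz) Vh) (subring_predX hS p Va).
  congr (V _); rewrite expr_div_n exprVn.
  by field; rewrite h1 !expf_neq0.
have [_ Va1] : a != 0 /\ V a^-1.
  apply: val_max_add1 => //; rewrite -[a - 1]invrK; apply: val_not_inv => //.
  by rewrite invr_eq0.
have cE : sigma (a - 1) / (a - 1) - 1 = (xi - 1) * a / (a - 1).
  by rewrite rmorphB rmorph1 /= sa; field.
exists (a - 1); rewrite cE; split=> //.
- by rewrite memvB ?mem1v.
- by rewrite !mulf_neq0 ?invr_eq0.
have := subring_predM hS (subring_predM hS (subring_predX hS p Vz) Vh) (subring_predX hS p Va1).
congr (V _); rewrite !expr_div_n exprMn exprVn.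
by field; rewrite h1 !expf_neq0.
Qed.

Hypothesis Vn : forall n, (0 < n < p)%N -> n%:R != 0 :> Om /\ V n%:R^-1.

Lemma frakA_exists b : odd p -> b \in L -> b != 0 -> sigma b / b - 1 != 0 ->
  exists h, [/\ frakA p K L h, h - 1 != 0 &
    V ((sigma b / b - 1) ^+ p / ((zeta - 1) ^+ p / (h - 1)))].
Proof.
move=> oddp Lb b0 c0; have [a [La a0 sa]] := kummer_exists.
set c := sigma b / b - 1 in c0 *.
have z0 : zeta - 1 != 0 by rewrite subr_eq0 zeta_neq1.
have ksig x : x \in L -> x != 0 -> (sigma x = zeta * x \/ sigma x = zeta^-1 * x) ->
    [/\ x \notin K, frakA p K L (x ^+ p) & x ^+ p - 1 != 0].
  move=> Lx x0 sx.
  have zeta0 : zeta != 0.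
    by apply: contraNneq a0 => E; rewrite -(fmorph_eq0 sigma) /= sa E mul0r.
  have xK : x \notin K.
    apply/negP => /sigmaK E; case: sx; rewrite E => E'.
      by move: zeta_neq1; rewrite -(inj_eq (mulIf x0)) -E' mul1r eqxx.
    move: zeta_neq1; rewrite -invr_eq1 -(inj_eq (mulIf x0)) -E' mul1r eqxx //.
  split=> //; last first.
    by rewrite subr_eq0; apply: contra xK => /eqP; exact: root1_K.
  apply: kummer_frakA => //; apply: sigma_fixed; rewrite ?rpredX // rmorphXn /=.
  by case: sx => ->; rewrite exprMn ?exprVn (prim_expr_order zetaP) ?invr1 mul1r.
have [aK _ _] := ksig a La a0 (or_introl sa).
have ak0 k : k \in K -> a - k != 0.
  by move=> Kk; rewrite subr_eq0; apply: contraNneq aK => ->.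
have degp : adjoin_degree K a = p.
  apply/eqP; rewrite -(eqn_pmul2r (adim_gt0 K)) -dim_Fadjoin.
  by rewrite kummer_generates // dimL.
have Kab : b \in <<K; a>>%VS by rewrite kummer_generates.
pose f := Fadjoin_poly K a b.
have fa : f.[a] = b by exact: Fadjoin_poly_eq.
have Kf : f \is a polyOver K by exact: Fadjoin_polyOver.
have fsa : f.[a + (zeta - 1) * a] = sigma b.
  have -> : a + (zeta - 1) * a = sigma a by rewrite sa; ring.
  by rewrite -fa -horner_map /= (fixedPoly_gal sKL sigma_gal Kf).
have Vd k : k \in K -> V ((zeta - 1) * a / (a - k)).
  move=> Kk; have -> : (zeta - 1) * a / (a - k) = sigma (a - k) / (a - k) - 1.
    by rewrite rmorphB /= sa (sigmaK Kk); field; exact: ak0.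
  by apply: (subring_predB hS); [apply: val_gal; exact: ak0 | exact: subring_pred1].
have [||k Kk] := cauchy_estimate ch0 hA0 hV VA0 p_pr Vn sKL dimL La aK Vd Kf.
- by rewrite fa.
- by rewrite -degp size_Fadjoin_poly.
rewrite fsa fa -/c => Vc.
(* If v(a) >= v(k), then v(a / k - 1) = v(a - k) - v(k), and v(c) >= v(z a) - v(a - k) >= v(z) - v(a
   / k - 1). *)
have [[k0 Vak]|nk] := boolp.pselect (k != 0 /\ V (a / k)).
  have ak_0 : a / k != 0 by rewrite mulf_neq0 ?invr_eq0.
  have Lak : a / k \in L by rewrite memvM // memvV (subvP sKL).
  have sak : sigma (a / k) = zeta * (a / k) by rewrite fmorph_div /= sa (sigmaK Kk) mulrA.
  have [akK Aak h0] := ksig _ Lak ak_0 (or_introl sak).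
  exists ((a / k) ^+ p); split=> //.
  have ak1 : a / k != 1 by apply: contraNneq akK => ->; rewrite mem1v.
  have [Vh _] := kummer_norm oddp Lak ak_0 ak1 zetaP sak zetaK.
  have := subring_predM hS (subring_predX hS p (subring_predM hS Vc Vak)) Vh.
  have -> : c * ((a - k) / ((zeta - 1) * a)) * (a / k) = c / (zeta - 1) * (a / k - 1).
    by field; rewrite z0 a0 k0.
  congr (V _); rewrite [(_ * (a / k - 1)) ^+ p]exprMn expr_div_n.
  by field; rewrite h0 !expf_neq0 // subr_eq0.
(* In the remaining case v(a - k) = v(a), so v(c) >= v(z). Then any Kummer generator a' in [V] will
   do, since v(a'^p - 1) >= 0; one of a, a^-1 is in [V]. *)
have Vcz : V (c / (zeta - 1)).
  have [k0|k0] := eqVneq k 0.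
    move: Vc; rewrite k0 subr0; congr (V _); by field; rewrite z0 a0.
  have nVak : ~ V (a / k) by move=> h; apply: nk.
  have [_ V1] : 1 - k / a != 0 /\ V (1 - k / a)^-1.
    apply: val_max_add1 => //; rewrite addrAC subrr add0r; apply: val_max_opp => //.
    rewrite -invf_div; apply: val_not_inv => //; first by rewrite mulf_neq0 ?invr_eq0.
  have := subring_predM hS Vc V1; congr (V _); field.
  by rewrite z0 a0 ak0.
have [a' [La' a'0 sa' Va']] : exists a', [/\ a' \in L, a' != 0,
    (sigma a' = zeta * a' \/ sigma a' = zeta^-1 * a') & V a'].
  have [h|h] := (proj2 hV) a a0; first by exists a; split=> //; left.
  exists a^-1; rewrite memvV invr_eq0; split=> //; right.
  by rewrite fmorphV /= sa invfM.
have [_ Aa' h0] := ksig _ La' a'0 sa'.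
exists (a' ^+ p); split=> //.
have := subring_predM hS (subring_predX hS p Vcz) (subring_predB hS (subring_predX hS p Va') (subring_pred1 hS)).
by congr (V _); rewrite expr_div_n; field; rewrite h0 expf_neq0.
Qed.

End KummerTower.

(** * The two ideals *)

Section IdealGen.
Variables (F0 : fieldType) (Om : splittingFieldType F0) (R S : Om -> Prop).

Lemma ideal_gen0 : ideal_gen R S 0.
Proof. by exists [::]; rewrite big_nil. Qed.

Lemma ideal_gen_add x y : ideal_gen R S x -> ideal_gen R S y -> ideal_gen R S (x + y).
Proof.
case=> r [hr ->] [s [hs ->]]; exists (r ++ s); rewrite big_cat; split=> // q.
by rewrite mem_cat => /orP[/hr|/hs].
Qed.

Lemma ideal_gen_gen a x : R a -> S x -> ideal_gen R S (a * x).
Proof.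
by move=> Ra Sx; exists [:: (a, x)]; rewrite big_seq1; split=> // q; rewrite inE => /eqP ->.
Qed.

Lemma ideal_gen_mul a x : (forall b, R b -> R (a * b)) ->
  ideal_gen R S x -> ideal_gen R S (a * x).
Proof.
move=> Ra [r [hr ->]]; exists [seq (a * q.1, q.2) | q <- r].
rewrite big_map mulr_sumr; split; last by apply: eq_bigr => q _; rewrite mulrA.
by move=> _ /mapP[q /hr[Rq Sq] ->]; split=> //; exact: Ra.
Qed.

Lemma ideal_gen_pick (V : Om -> Prop) x : valuation_ring V -> (forall a, R a -> V a) ->
  ideal_gen R S x -> x != 0 -> exists y, [/\ S y, y != 0 & V (x / y)].
Proof.
move=> hV RV [r [hr ->]] x0; have [q [rq q0 Vq]] := val_sum_pick hV x0.
have [Rq Sq] := hr q rq; move: (q0); rewrite mulf_eq0 negb_or => /andP[q10 q20].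
exists q.2; split=> //; have := subring_predM (proj1 hV) Vq (RV _ Rq).
by congr (V _); field; rewrite q10 q20.
Qed.

End IdealGen.

Lemma coprime_val_unit (M : fieldType) (V : M -> Prop) (p n : nat) :
  valuation_ring V -> prime p -> val_max V p%:R -> (0 < n < p)%N ->
  n%:R != 0 :> M /\ V n%:R^-1.
Proof.
move=> hV p_pr maxp /andP[n0 np]; apply: val_not_max; first exact: (subring_pred_nat (proj1 hV)).
move=> maxn; apply: (@val_max1 M V hV).
have [u v E _] := egcdnP p n0; move: E.
have -> : gcdn n p = 1%N by apply/eqP; rewrite -/(coprime n p) coprime_sym prime_coprime // gtnNdvd.
move=> E; have -> : 1 = u%:R * n%:R - v%:R * p%:R :> M.
  by rewrite -!natrM E natrD addrAC subrr add0r.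
have hS := proj1 hV.
apply: val_max_add => //.
  by rewrite mulrC; apply: val_max_mul => //; exact: subring_pred_nat.
by apply: val_max_opp => //; rewrite mulrC; apply: val_max_mul => //; exact: subring_pred_nat.
Qed.

Lemma henselian_hensel (F0 : fieldType) (Om : splittingFieldType F0) (A : Om -> Prop) :
  (forall x, A x -> x \in 1%VS) -> henselian A -> hensel (fun k : F0 => A k%:A).
Proof.
move=> A1 hA f a fmon Af Aa fa f'a.
have algV (k : F0) : (k%:A : Om)^-1 = k^-1%:A by exact/esym/(fmorphV (in_alg Om)).
have maxE k : vmax A k%:A <-> val_max (fun k : F0 => A k%:A) k.
  rewrite /vmax /val_max algV; split=> -[h1 h2]; split=> //.
    by case: h2 => [/eqP|]; [rewrite scaler_eq0 oner_eq0 orbF => /eqP; left | right].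
  by case: h2 => [->|]; [left; rewrite scale0r | right].
have horE (q : {poly F0}) k : (map_poly (in_alg Om) q).[k%:A] = q.[k]%:A.
  exact: (horner_map (in_alg Om)).
have [||||| b [Ab fb ba]] := hA (map_poly (in_alg Om) f) a%:A.
- by rewrite map_monic.
- by move=> i; rewrite coef_map; exact: Af.
- by [].
- by rewrite horE; apply/maxE.
- by rewrite deriv_map horE => /maxE.
have /vlineP[k bk] := A1 b Ab; exists k; rewrite -bk; split=> //.
  by move/eqP: fb; rewrite bk horE scaler_eq0 oner_eq0 orbF => /eqP.
by apply/maxE; rewrite scalerBl -bk.
Qed.

Theorem theorem7p8 (F0 : fieldType) (Om : splittingFieldType F0)
  (p : nat) (A' B : Om -> Prop) (L' K L : {subfield Om}) (zeta : Om)
  (sigma : gal_of L) :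
  [pchar F0] =i pred0 ->
  prime p -> (2 < p)%N ->
  is_valuation_ring 1%VS A' -> henselian A' ->
  vmax A' (p%:R) ->
  galois 1 L' -> \dim L' = p ->
  p.-primitive_root zeta ->
  K = <<1; zeta>>%AS -> L = <<L'; zeta>>%AS ->
  is_valuation_ring L B -> (forall x, x \in (1%VS : {vspace Om}) -> (B x <-> A' x)) ->
  ('Gal(L / K) = <[sigma]>)%g ->
  let A := setI_sp B K in
  let B' := setI_sp B L' in
  forall x, calH' p zeta K L L' A x <-> @calN' F0 Om L L' sigma A' B' x.
Proof.
move=> ch0 p_pr p2 hA' henA' maxp galL' dimL' zetaP defK defL hB BA' defG A B' x.
have [A'1 A'_0 A'_1 A'op A'tot] := hA'.
have [BL B_0 B_1 Bop Btot] := hB.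
have oddp : odd p by case: (even_prime p_pr) => // p_2; rewrite p_2 in p2.
(* [B] is a valuation ring of L only, whereas the preceding lemmas want one of the ambient field. *)
have [W hW WB] : exists2 W, valuation_ring W & forall y, y \in L -> (W y <-> B y).
  apply: (@val_extension _ (fun y => y \in L)) => //; last by move=> y z Ly Lz; rewrite memvM // memvV.
pose A0 := fun k : F0 => A' k%:A.
have hA0 : hensel A0 by apply: henselian_hensel.
have sL1 y : y \in 1%VS -> y \in L by apply/subvP/sub1v.
have WA1 y : y \in 1%VS -> W y <-> A' y.
  by move=> y1; rewrite -BA' // WB // sL1.
have WA0 k : W k%:A <-> A0 k by apply: WA1; rewrite memvZ ?mem1v.
have hS := proj1 hW.
have sKL := sKL defK defL; have sL'L := sL'L defL.
have AW y : A y -> W y by case=> By Ky; apply/WB => //; exact: BL.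
have B'W y : B' y -> W y by case=> By Ly; apply/WB => //; exact: BL.
have WA y : y \in K -> W y -> A y by move=> Ky Wy; split=> //; apply/WB => //; exact: (subvP sKL).
have Vn n : (0 < n < p)%N -> n%:R != 0 :> Om /\ W n%:R^-1.
  apply: coprime_val_unit => //; case: maxp => A'p hp.
  have p1 : p%:R \in (1%VS : {vspace Om}) := A'1 _ A'p.
  split; first exact/WA1.
  case: hp => [|hp]; [by left | right => Wp; apply: hp; apply/WA1 => //].
  by rewrite (memvV 1%AS).
have Kz : zeta \in K := zetaK defK.
have z0 : zeta - 1 != 0 by rewrite subr_eq0 (zeta_neq1 p_pr zetaP).
have normE j : j \in L' -> j != 0 -> let N := galNorm 1%VS L' j in
    [/\ N \in 1%VS, N != 0, W (N / j ^+ p) & W (j ^+ p / N)].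
  move=> L'j j0 N; have card : #|'Gal(L' / 1)%g| = p.
    by rewrite -(galois_dim galL') dimv1 divn1.
  have jp : j ^+ p = \prod_(g in 'Gal(L' / 1)%g) j by rewrite prodr_const card.
  split; first exact: mem_galNorm; first by rewrite galNorm_eq0.
    by rewrite jp -prodf_div; apply: (subring_pred_prod hS) => g _; exact: (val_gal ch0 hA0 hW WA0).
  by rewrite jp -prodf_div; apply: (subring_pred_prod hS) => g _; exact: (val_galV ch0 hA0 hW WA0).
have div1 y y' : y \in 1%VS -> y' \in 1%VS -> y / y' \in (1%AS : {subfield Om}).
  by move=> hy hy'; rewrite memvM // memvV.
have L'delta b : b \in L' -> sigma b / b - 1 \in L'.
  by move=> L'b; rewrite memvB ?mem1v // memvM ?memvV // (sigmaL' sigma galL').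
have Kzh h : frakA p K L h -> (zeta - 1) ^+ p / (h - 1) \in K.
  by case=> Kh _; rewrite memvM ?rpredX ?memvB ?mem1v // memvV memvB ?mem1v.
split.
  case=> Hx fixx; have [->|x0] := eqVneq x 0; first exact: ideal_gen0.
  have Kx : x \in K.
    case: Hx => rs [hrs ->]; rewrite big_seq; apply: memv_suml => q /hrs[[_ Kq] [h [frh ->]]].
    by rewrite memvM // Kzh.
  have L'x : x \in L'.
    rewrite -(galois_fixedField (galL'L ch0 galL' zetaP defK defL)).
    by apply/fixedFieldP => //; exact: (subvP sKL).
  have x1 := KL'_alg p_pr dimL' zetaP defK Kx L'x.
  have [_ [[h [frh ->]] y0 Vx]] := ideal_gen_pick hW AW Hx x0.
  have h1 : h - 1 != 0 by move: y0; rewrite mulf_eq0 invr_eq0 negb_or => /andP[].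
  have [b [L'b b0 c0 Vc]] := frakA_bound ch0 p_pr galL' dimL' zetaP defK defL defG hA0 hW WA0 oddp frh.
  set c := sigma b / b - 1 in c0 Vc.
  have L'c : c \in L' by exact: L'delta.
  have [N1 N0 _ VN] := normE c L'c c0.
  (* The cofactor x / N is in A' because v(x) >= v(z^p / (h - 1)) >= p v(c) = v(N). *)
  rewrite -(divfK N0 x); apply: ideal_gen_gen.
    apply/WA1; first exact: div1.
    have := subring_predM hS (subring_predM hS Vx Vc) VN; congr (W _); field.
    by rewrite h1 N0 !expf_neq0.
  exists c; split=> //; rewrite -[c]mul1r; apply: ideal_gen_gen; last by exists b.
  by split; rewrite ?mem1v.
have L'J j : @calJ' F0 Om L L' sigma B' j -> j \in L'.
  case=> ss [hss ->]; rewrite big_seq; apply: memv_suml => q /hss[[_ L'q] [b [L'b b0 ->]]].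
  by rewrite memvM // L'delta.
case=> rs [hrs ->]; split; last first.
  move=> tau tauG; apply: fixed_gal sL'L tauG _.
  rewrite big_seq; apply: memv_suml => q /hrs[A'q [j [Jj ->]]].
  rewrite memvM //; apply: (subvP (sub1v L')); first exact: A'1.
  by apply: mem_galNorm => //; exact: L'J.
rewrite big_seq; elim/big_ind: _ => [|y1 y2 h1 h2|q /hrs[A'q [j [Jj ->]]]].
- exact: ideal_gen0.
- exact: ideal_gen_add.
have Aq : A q.1.
  have q1 := A'1 _ A'q; apply: WA; last exact/WA1.
  exact: (subvP (sub1v K)).
apply: ideal_gen_mul => [a Aa|].
  by apply: WA; [rewrite memvM //; [case: Aq | case: Aa] | exact: (subring_predM hS (AW _ Aq) (AW _ Aa))].
have [j0|j0] := eqVneq j 0; first by rewrite j0 galNorm0; exact: ideal_gen0.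
have [N1 N0 VN _] := normE j (L'J j Jj) j0.
(* Some c = sigma b / b - 1 has v(j) >= v(c); then v(N(j)) = p v(j) >= p v(c) >= v(z^p / (h - 1))
   for the h attached to b. *)
have [y [[b [L'b b0 ->]] c0 Vj]] := ideal_gen_pick hW B'W Jj j0.
set c := sigma b / b - 1 in c0 Vj.
have [h [frh h0 Vc]] := frakA_exists ch0 p_pr galL' dimL' zetaP defK defL defG hA0 hW WA0 Vn
  oddp (subvP sL'L _ L'b) b0 c0.
have zh0 : (zeta - 1) ^+ p / (h - 1) != 0 by rewrite mulf_neq0 ?invr_eq0 ?expf_neq0.
rewrite -(divfK zh0 (galNorm _ _ _)); apply: ideal_gen_gen; last by exists h.
apply: WA.
  rewrite memvM //; first exact: (subvP (sub1v K)).
  by rewrite memvV Kzh.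
have := subring_predM hS (subring_predM hS VN (subring_predX hS p Vj)) Vc; congr (W _); rewrite expr_div_n; field.
by rewrite h0 !expf_neq0.
Qed.
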